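(* Let $\mathcal{C}$ be the set of convex partitions, i.e. partitions $\lambda_1\ge\lambda_2\ge\cdots\ge\lambda_\ell>0$ with $\lambda_1-\lambda_2\ge\lambda_2-\lambda_3\ge\cdots\ge\lambda_{\ell-1}-\lambda_\ell\ge\lambda_\ell>0$. Let $C(x)$ denote the limit shape of $\mathcal{C}$ and $C^{(-1)}$ its compositional inverse. Then \[ C^{(-1)}(x)=\int_x^\infty (y-x)\,\frac{e^{-c\frac12y^2}}{1-e^{-c\frac12 y^2}}\,dy,\qquad x>0,\qquad\text{where } c=\tfrac12\,\pi^{1/3}\zeta\!\left(\tfrac32\right)^{2/3}. \]
   Context: For a partition $\lambda$ of $n$ let $m_k(\lambda)$ be the number of parts equal to $k$ and $D_\lambda(t)=\sum_{k\ge t}m_k(\lambda)$, $t>0$. For a scaling function $\alpha$ (positive, increasing, $\alpha(n)\to\infty$), $\widehat D_\lambda(t)=\frac{\alpha(n)}{n}D_\lambda(\alpha(n)t)$. For a set $\mathcal{A}$ of partitions with $\mathcal{A}_n$ its elements of size $n$ and $\mathbb{P}_n$ uniform on $\mathcal{A}_n$, a piecewise continuous $\Phi:\mathbb{R}_+\to\mathbb{R}_+$ with $\int_0^\infty\Phi=1$ is the limit shape of $\mathcal{A}$ (under $\alpha$) if for every finite set of continuity points $t_1<\dots<t_k$ of $\Phi$ and every $\epsilon>0$, $\mathbb{P}_n(|\widehat D_\lambda(t_j)-\Phi(t_j)|<\epsilon\ \forall j)\to1$. $\zeta$ is the Riemann zeta function. *)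

(* Defs.v *)
From HB Require Import structures.
From mathcomp Require Export all_boot all_order all_algebra finmap.
From mathcomp Require Export all_classical all_reals all_analysis.
Set Implicit Arguments.
Unset Strict Implicit.
Unset Printing Implicit Defensive.
Export Order.TTheory GRing.Theory Num.Theory.
Export numFieldNormedType.Exports.
Global Open Scope classical_set_scope.
Global Open Scope ring_scope.

Definition is_partition (l : seq nat) : Prop :=
  sorted geq l /\ all (fun k => 0 < k)%N l.

(* Parts are indexed from 0, and the default value nth 0 l (size l) = 0 turns
   the last inequality of the chain (i + 2 = size l) into
   lambda_(l-1) - lambda_l >= lambda_l.  The truncated subtractions are exact
   because l is nonincreasing. *)
Definition convex_partitions : set (seq nat) :=
  [set l | is_partition l /\
    forall i : nat, (i.+1 < size l)%N ->
      (nth 0 l i.+1 - nth 0 l i.+2 <= nth 0 l i - nth 0 l i.+1)%N].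

Definition of_size (A : set (seq nat)) (n : nat) : set (seq nat) :=
  [set l | A l /\ sumn l = n].

(* fset_set is only meaningful on finite sets, hence this fact. *)
Lemma finite_of_size (A : set (seq nat)) (n : nat) :
  (forall l, A l -> is_partition l) -> finite_set (of_size A n).
Proof.
move=> Apart; apply: (@sub_finite_set _ _
  ((fun b : {bseq n of 'I_n.+1} => [seq val i | i <- b]) @` setT)); last first.
  exact/finite_image/finite_finset.
move=> l [/Apart[_ lpos] ln].
have size_le s : all (fun k => 0 < k)%N s -> (size s <= sumn s)%N.
  by elim: s => //= a s IH /andP[a0 /IH]; rewrite -add1n; exact: leq_add.
have part_le s k : k \in s -> (k <= sumn s)%N.
  elim: s => //= a s IH; rewrite inE => /predU1P[->|/IH]; first exact: leq_addr.
  by move=> /leq_trans; apply; exact: leq_addl.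
have sz : (size [seq (inord k : 'I_n.+1) | k <- l] <= n)%N.
  by rewrite size_map -ln; exact: size_le.
exists (Bseq sz) => //=; rewrite -map_comp -[RHS]map_id.
by apply/eq_in_map => k /part_le kl /=; rewrite inordK// ltnS -ln.
Qed.

Section LimitShape.
Variable R : realType.
Implicit Types (alpha : nat -> R) (A : set (seq nat)) (Phi : R -> R).

Definition uniform_prob_of_size A (n : nat) (E : set (seq nat)) : R :=
  #|` fset_set (of_size A n `&` E)|%:R / #|` fset_set (of_size A n)|%:R.

Definition mult (k : nat) (l : seq nat) : nat := count_mem k l.

(* The sum over all k >= t, truncated at |lambda|, which bounds every part. *)
Definition diagram (l : seq nat) (t : R) : R :=
  (\sum_(1 <= k < (sumn l).+1 | (t <= k%:R)%R) mult k l)%N%:R.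

Definition scaled_diagram alpha (l : seq nat) (t : R) : R :=
  let n := sumn l in alpha n / n%:R * diagram l (alpha n * t).

(* The values at n = 0 play no role. *)
Definition scaling_function alpha : Prop :=
  [/\ forall n, (0 < n)%N -> 0 < alpha n,
      forall m n, (0 < m)%N -> (m < n)%N -> alpha m < alpha n
    & alpha n @[n --> \oo] --> +oo].

Definition piecewise_continuous_pos Phi : Prop :=
  (forall a b : R, 0 < a -> a < b ->
     finite_set [set t : R | a <= t <= b /\ ~ {for t, continuous Phi}]) /\
  (forall t : R, 0 < t -> cvg (Phi x @[x --> t^'-]) /\ cvg (Phi x @[x --> t^'+])).

(* Functions on R_+ = ]0, +oo[ are represented by total functions whose values
   outside ]0, +oo[ are irrelevant; a limit shape may be unbounded near 0. *)
Definition is_limit_shape alpha A Phi : Prop :=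
  [/\ scaling_function alpha,
      forall t : R, 0 < t -> 0 <= Phi t,
      piecewise_continuous_pos Phi,
      (\int[lebesgue_measure]_(t in `]0%R, +oo[) (Phi t)%:E = 1)%E
    & forall (ts : seq R) (eps : R),
        sorted <%R ts ->
        (forall t, t \in ts -> 0 < t /\ {for t, continuous Phi}) ->
        0 < eps ->
        uniform_prob_of_size A n
          [set l | forall t, t \in ts ->
             `|scaled_diagram alpha l t - Phi t| < eps]
          @[n --> \oo] --> (1 : R)].

(* f and g are mutually inverse bijections of ]0, +oo[. *)
Definition comp_inverse_pos (f g : R -> R) : Prop :=
  (forall t : R, 0 < t -> 0 < f t /\ g (f t) = t) /\
  (forall x : R, 0 < x -> 0 < g x /\ f (g x) = x).

(* Real s > 1 only, where the Dirichlet series converges. *)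
Definition zeta (s : R) : R := limn (series (riemannR s)).

Definition convex_const : R :=
  2^-1 * pi `^ (3^-1) * zeta (3 / 2) `^ (2 / 3).

End LimitShape.

(* Main.v *)
Require Import Defs.
From mathcomp Require Import measurable_realfun ring lra zify.
Set Implicit Arguments.
Unset Strict Implicit.
Unset Printing Implicit Defensive.

(** The second differences of a convex partition are the multiplicities of a
    partition of n into triangular numbers, so convex partitions of n are the
    configurations (e_j) with sum_j tri_j e_j = n.  Weight them by
    exp (- c h^2 sum_j tri_j e_j) with h = n^(-1/3): the e_j become independent
    geometric variables, and the mean of the rescaled row of index x / h
    converges, by Riemann sums, to the integral defining C^(-1)(x).  Chernoff
    bounds show that rows deviate with Boltzmann probability at most
    exp (- eta / h).  No local limit theorem is needed to condition on size n:
    adding parts 1 shows that the number of configurations is monotone in n, so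
    concentration of the size at a slightly larger mesh bounds the number of
    convex partitions of n below by Z exp (c / h) exp (- kappa / h) / poly(n) for
    every kappa > 0. *)

(** All configurations of size n have the same Boltzmann weight exp (- c / h), so a Boltzmann bound
    for a set of them is a bound for their number, at most Z exp (c / h) exp (- eta / h). In the
    quotient by the lower bound for the total, the factor Z exp (c / h) cancels; Z is never
    evaluated, and kappa below eta leaves a factor that beats every polynomial in n. Rows are linear
    in the e_j while the diagram function is not. So row i is estimated, for i of order 1 / h, and
    conjugation carries the result over to the diagram; this is why the explicit formula is for
    C^(-1). The obstacle is the singularity of order y^(-2) of the occupation density at y = 0. It
    makes C^(-1) unbounded there, so row estimates need i h bounded away from 0, and sums are
    compared with integrals by monotonicity instead of uniform continuity. The cut-offs J (columns)
    and K (values) make everything finite; the Chernoff bounds are uniform in both, so these can be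
    chosen last, depending on n. *)

Local Notation cvx := convex_partitions.

(** * Geometric weights and Chernoff bounds *)

Ltac positive_neq0 := do ?[apply/andP; split]; apply: lt0r_neq0; lra.

(** Mean of the geometric variable that gives k the weight exp (- u k). *)
Definition bose (R : realType) (u : R) : R := expR (- u) / (1 - expR (- u)).

Lemma boseE (R : realType) (u : R) : 0 < u -> bose u = (expR u - 1)^-1.
Proof.
move=> u0; rewrite /bose expRN.
have e1 : 1 < expR u by rewrite expR_gt1.
have e0 : 0 < expR u by exact: expR_gt0.
by field; positive_neq0.
Qed.

Lemma bose_gt0 (R : realType) (u : R) : 0 < u -> 0 < bose u.
Proof. by move=> u0; rewrite boseE// invr_gt0 subr_gt0 expR_gt1. Qed.

Lemma bose_le (R : realType) (u v : R) : 0 < u -> u <= v -> bose v <= bose u.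
Proof.
move=> u0 uv; rewrite !boseE ?(lt_le_trans u0)// lef_pV2 ?posrE ?subr_gt0 ?expR_gt1//.
  by rewrite lerD2r ler_expR.
exact: lt_le_trans uv.
Qed.

Lemma mul_bose_ge0 (R : realType) (u : R) : 0 < u -> 0 <= u * bose u.
Proof. by move=> u0; rewrite mulr_ge0 ?ltW// bose_gt0. Qed.

Lemma mul_bose_le1 (R : realType) (u : R) : 0 < u -> u * bose u <= 1.
Proof.
move=> u0; rewrite boseE// ler_pdivrMr ?mul1r ?subr_gt0 ?expR_gt1//.
by have := expR_ge1Dx u; lra.
Qed.

(* Convexity of exp between 0 and v, from the tangent at u. *)
Lemma mul_bose_le (R : realType) (u v : R) : 0 < u -> u <= v ->
  v * bose v <= u * bose u.
Proof.
move=> u0 uv; have v0 : 0 < v by exact: lt_le_trans uv.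
rewrite !boseE// ler_pdivlMr ?subr_gt0 ?expR_gt1// mulrAC.
rewrite ler_pdivrMr ?subr_gt0 ?expR_gt1//.
have a : (1 - u) * expR u <= 1.
  have := expR_ge1Dx (- u); rewrite expRN => h.
  by rewrite -ler_pdivlMr ?expR_gt0// mul1r.
have b : (1 + v - u) * expR u <= expR v.
  have := expR_ge1Dx (v - u); rewrite expRB => h.
  by rewrite -ler_pdivlMr ?expR_gt0//; lra.
have : (v - u) * ((1 - u) * expR u) + u * ((1 + v - u) * expR u)
    <= (v - u) * 1 + u * expR v.
  by apply: lerD; rewrite ler_wpM2l//; lra.
lra.
Qed.

Lemma inv_1B_le_exp (R : realType) (z : R) : z <= 4^-1 ->
  (1 - z)^-1 <= expR (z + 2 * z ^+ 2).
Proof.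
move=> z4; rewrite (@le_trans _ _ (1 + (z + 2 * z ^+ 2)))//; last exact: expR_ge1Dx.
rewrite -[leLHS]mul1r ler_pdivrMr; last by lra.
have : 0 <= z ^+ 2 * (1 - 2 * z) by rewrite mulr_ge0 ?sqr_ge0//; lra.
lra.
Qed.

(** Algebra for [geom_tilt], used with w = u / 4 and E = exp w. As E^4 - 1 = (E - 1) (E + 1) (E^2 +
    1), the number q is then 4 E bose u / bose w; its bounds say that a stray factor exp (u / 4) is
    absorbed by replacing bose u with bose (u / 4). *)
Lemma tilt_frac (R : realType) (E w : R) : 1 < E -> 0 <= w -> w <= E - 1 ->
  let q := 4 * E * ((E + 1) * (E ^+ 2 + 1))^-1 in
  [/\ 0 <= q, q <= 1, w * q <= 2,
      ((E - 1) * ((E + 1) * (E ^+ 2 + 1)))^-1 * E = (E - 1)^-1 * q / 4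
    & 0 <= w * (E - 1)^-1 <= 1].
Proof.
move=> E1 w0 wE q.
have Em1 : 0 < E - 1 by lra.
have E0 : 0 < E by lra.
have E2 : 0 < E ^+ 2 by rewrite exprn_gt0.
have Ep1 : 0 < E + 1 by lra.
have E21 : 0 < E ^+ 2 + 1 by lra.
have Ep : 0 < (E + 1) * (E ^+ 2 + 1) by rewrite mulr_gt0.
split.
- by rewrite mulr_ge0 ?invr_ge0 ?ltW// mulr_gt0.
- rewrite ler_pdivrMr// mul1r.
  have : 0 <= (E + 1) * (E - 1) ^+ 2 by rewrite mulr_ge0 ?sqr_ge0 ?ltW.
  have : 0 <= 2 * E * (E - 1) by rewrite !mulr_ge0 ?ltW.
  lra.
- rewrite /q mulrA ler_pdivrMr//.
  have : 0 <= 4 * (E - 1 - w) * E by rewrite !mulr_ge0 ?(ltW E0)// subr_ge0.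
  have : 0 <= 2 * E * (E - 1) ^+ 2 by rewrite !mulr_ge0 ?sqr_ge0 ?ltW.
  have : 0 <= (E - 1) ^+ 2 by rewrite sqr_ge0.
  lra.
- by rewrite /q; field; rewrite !gt_eqF.
- by rewrite ler_pdivrMr// mul1r wE mulr_ge0// invr_ge0 ltW.
Qed.

(** [E] dominates exp at 0 and at [v], hence between them, so the Taylor bounds of orders one and
    two hold for either sign of [v]. *)
Lemma expR_subr1_bounds (R : realType) (v E : R) : 1 <= E -> expR v <= E ->
  `|expR v - 1| <= `|v| * E /\ expR v - 1 - v <= v ^+ 2 * E.
Proof.
move=> E1 evE.
have ev0 := expR_gt0 v.
have evm1 : expR v - 1 <= v * expR v.
  have := expR_ge1Dx (- v); rewrite expRN => h.
  have : (1 - v) * expR v <= 1 by rewrite -ler_pdivlMr// mul1r.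
  lra.
have evp1 := expR_ge1Dx v.
have abs1 : `|expR v - 1| <= `|v| * E.
  have [vp|vn] := leP 0 v.
    rewrite !ger0_norm//; last by lra.
    by rewrite (le_trans evm1)// ler_wpM2l.
  rewrite (ltr0_norm vn) ler0_norm; last first.
    by rewrite subr_le0 expR_le1 ltW.
  have : 0 <= (- v) * (E - 1) by rewrite mulr_ge0; lra.
  lra.
split=> //.
rewrite (@le_trans _ _ (v * (expR v - 1)))//.
  have [vp|vn] := leP 0 v; first by nra.
  have : 0 <= (- v) * (expR v - 1 - v) by rewrite mulr_ge0; lra.
  nra.
rewrite (@le_trans _ _ (`|v| * `|expR v - 1|))//; first by rewrite -normrM ler_norm.
by rewrite -(@real_normK _ v) ?num_real// expr2 -mulrA ler_wpM2l.
Qed.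

(** Bounds the moment generating function at [v] of the geometric variable of energy [u]. It equals
    1 / (1 - z) with z = bose u (exp v - 1), which is at most exp (z + 2 z^2). Since |v| <= u / 4,
    the factor exp v is paid for by having u / 4 in the error term. The constant 10 is 8 from
    linearizing z plus 2 from 2 z^2. *)
Lemma geom_tilt (R : realType) (u v rho : R) : 0 < u -> 0 <= rho -> rho <= 4^-1 ->
  `|v| <= rho * u ->
  expR (- u + v) < 1 /\
  (1 - expR (- u + v))^-1 <= (1 - expR (- u))^-1 *
    expR (v * bose u + 10 * rho ^+ 2 * (u / 4 * bose (u / 4))).
Proof.
move=> u0 r0 r4 vru.
set w := u / 4; set E := expR w.
have w0 : 0 < w by rewrite divr_gt0.
have uw : u = 4 * w by rewrite /w; field.
have E1 : 1 < E by rewrite expR_gt1.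
have wE : w <= E - 1 by have := expR_ge1Dx w; rewrite -/E; lra.
have eu : expR u = E ^+ 4 by rewrite uw -[4]/(4%:R) expRM_natl.
have vw : `|v| <= 4 * rho * w by rewrite (le_trans vru)// uw; lra.
have vw1 : `|v| <= w.
  rewrite (le_trans vw)// -[leRHS]mul1r ler_wpM2r//; lra.
have evE : expR v <= E by rewrite ler_expR (le_trans (ler_norm _)).
have [abs1 sq] := expR_subr1_bounds (ltW E1) evE.
have [q0 q1 wq2 qE /andP[wl0 wl1]] := tilt_frac E1 (ltW w0) wE.
set q := _ * _ in q0 q1 wq2 qE.
have bu : bose u = ((E - 1) * ((E + 1) * (E ^+ 2 + 1)))^-1.
  by rewrite boseE// eu; congr (_^-1); ring.
have bw : bose w = (E - 1)^-1 by rewrite boseE.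
have E0 : 0 < E by exact: expR_gt0.
rewrite -bu in qE; rewrite -bw in wl0 wl1 qE; rewrite bw.
move: q q0 q1 wq2 qE => q q0 q1 wq2 qE.
rewrite -bw; have [k kE] : exists k, w * bose w = k by exists (w * bose w).
rewrite kE in wl0 wl1 *.
set a := bose u; have a0 : 0 < a by exact: bose_gt0.
set z := a * (expR v - 1).
have rk0 : 0 <= rho * k by exact: mulr_ge0.
have r20 : 0 <= rho ^+ 2 by rewrite sqr_ge0.
have vr2 : v ^+ 2 <= 16 * rho ^+ 2 * w ^+ 2.
  rewrite -real_normK ?num_real//.
  rewrite (_ : 16 * rho ^+ 2 * w ^+ 2 = (4 * rho * w) ^+ 2); last by ring.
  by rewrite lerXn2r// nnegrE !mulr_ge0// ltW.
have zabs : `|z| <= rho * k * q.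
  rewrite normrM (gtr0_norm a0) (@le_trans _ _ (a * (4 * rho * w * E)))//.
    by rewrite ler_pM2l// (le_trans abs1)// ler_pM2r.
  rewrite (_ : a * _ = (a * E) * (4 * rho * w)); last by ring.
  by rewrite qE -kE le_eqVlt; apply/orP; left; apply/eqP; field.
have zk : `|z| <= rho * k by rewrite (le_trans zabs)// ler_piMr.
have z4 : z <= 4^-1.
  by rewrite (le_trans (ler_norm _))// (le_trans zk)// -[leRHS]mulr1 ler_pM.
have z2 : z ^+ 2 <= rho ^+ 2 * k.
  rewrite -real_normK ?num_real//.
  rewrite (@le_trans _ _ ((rho * k) ^+ 2))//; first by rewrite lerXn2r.
  by rewrite exprMn ler_wpM2l// expr2 ler_piMr.
have zv : z <= v * a + 8 * rho ^+ 2 * k.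
  have h : a * (expR v - 1 - v) <= 8 * rho ^+ 2 * k.
    rewrite (@le_trans _ _ (a * (16 * rho ^+ 2 * w ^+ 2 * E)))//.
      by rewrite ler_pM2l// (le_trans sq)// ler_pM2r.
    rewrite (_ : a * _ = (a * E) * (16 * rho ^+ 2 * w ^+ 2)); last by ring.
    rewrite qE (_ : _ / 4 * _ = (4 * rho ^+ 2 * k) * (w * q)); last first.
      by rewrite -kE; field.
    rewrite (_ : 8 * _ * _ = (4 * rho ^+ 2 * k) * 2); last by ring.
    by rewrite ler_wpM2l// !mulr_ge0.
  by rewrite /z mulrBr in h *; move: h; rewrite !mulrBr mulr1 (mulrC a v); clear; lra.
have fac : 1 - expR (- u + v) = (1 - expR (- u)) * (1 - z).
  have eu1 : 1 < expR u by rewrite expR_gt1.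
  rewrite expRD /z /a boseE// expRN; field.
  by clear -eu1; positive_neq0.
have eu0 : 0 < 1 - expR (- u) by rewrite subr_gt0 expR_lt1 oppr_lt0.
split.
  by rewrite -subr_gt0 fac mulr_gt0// subr_gt0 (le_lt_trans z4)// invf_lt1// ltr1n.
rewrite fac invfM ler_pM2l ?invr_gt0// (le_trans (inv_1B_le_exp z4))//.
rewrite ler_expR -/a; clear -z2 zv; lra.
Qed.

Lemma geom_sum_le (R : realType) (r : R) (K : nat) : 0 <= r -> r < 1 ->
  \sum_(k < K) r ^+ k <= (1 - r)^-1.
Proof.
move=> r0 r1; rewrite -[leRHS]mul1r ler_pdivlMr; last by lra.
rewrite mulrC.
have -> : (1 - r) * (\sum_(k < K) r ^+ k) = 1 - r ^+ K.
  rewrite -[in RHS](expr1n _ K) subrXX; congr (_ * _).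
  by apply: eq_bigr => i _; rewrite expr1n mul1r.
by rewrite gerBl exprn_ge0.
Qed.

Lemma sum_ffun_exp (R : realType) (J K : nat) (u : nat -> R) :
  \sum_(e : {ffun 'I_J -> 'I_K}) expR (\sum_(j < J) u j * (e j)%:R) =
  \prod_(j < J) \sum_(k < K) expR (u j) ^+ k.
Proof.
rewrite bigA_distr_bigA/=; apply: eq_bigr => e _.
by rewrite expR_sum; apply: eq_bigr => j _; rewrite expRM_natr.
Qed.

Definition boltz (R : realType) (J K : nat) (u : nat -> R)
  (e : {ffun 'I_J -> 'I_K}) : R := expR (- \sum_(j < J) u j * (e j)%:R).

(** The geometric series are summed in full, so this dominates the total of [boltz u] over
    configurations with values below [K], whatever [K] is. *)
Definition partition_fun (R : realType) (J : nat) (u : nat -> R) : R :=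
  \prod_(j < J) (1 - expR (- u j))^-1.

Lemma partition_fun_gt0 (R : realType) (J : nat) (u : nat -> R) :
  (forall j, 0 < u j) -> 0 < partition_fun J u.
Proof.
by move=> u0; apply: prodr_gt0 => j _; rewrite invr_gt0 subr_gt0 expR_lt1 oppr_lt0.
Qed.

(** Exponential Markov inequality: the indicator of [P] is at most exp (sum v_j e_j - B), the tilted
    sum factors over the coordinates, and [geom_tilt] bounds each factor. The sign of [v] is free,
    so both tails are covered. *)
Lemma chernoff (R : realType) (J K : nat) (u v : nat -> R) (rho B : R)
    (P : pred {ffun 'I_J -> 'I_K}) :
  (forall j, 0 < u j) -> 0 <= rho -> rho <= 4^-1 ->
  (forall j, `|v j| <= rho * u j) ->
  (forall e, P e -> B <= \sum_(j < J) v j * (e j)%:R) ->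
  \sum_(e | P e) boltz u e <= partition_fun J u *
    expR (- B + \sum_(j < J) v j * bose (u j)
          + 10 * rho ^+ 2 * \sum_(j < J) (u j / 4 * bose (u j / 4))).
Proof.
move=> u0 r0 r4 vru PB.
have gt j := geom_tilt (u0 j) r0 r4 (vru j).
apply: (@le_trans _ _ (expR (- B) *
   \sum_(e : {ffun 'I_J -> 'I_K}) expR (\sum_(j < J) (- u j + v j) * (e j)%:R))).
  rewrite mulr_sumr big_mkcond/=; apply: ler_sum => e _.
  case: ifPn => [Pe|_]; last by rewrite mulr_ge0 ?expR_ge0.
  rewrite -expRD ler_expR.
  under [in leRHS]eq_bigr do rewrite mulrDl mulNr.
  by rewrite big_split/= sumrN; have := PB _ Pe; lra.
rewrite (sum_ffun_exp J K (fun j => - u j + v j)) -addrA expRD mulrCA ler_wpM2l ?expR_ge0//.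
rewrite mulr_sumr -big_split/= expR_sum /partition_fun -big_split/=.
apply: ler_prod => j _; have [e1 le1] := gt j; apply/andP; split.
  by apply: sumr_ge0 => k _; rewrite exprn_ge0 ?expR_ge0.
by apply: le_trans le1; apply: geom_sum_le; rewrite ?expR_ge0.
Qed.

(** * Convex partitions and triangular numbers *)

(** The size 1 + 2 + ... + (j + 1) of the staircase with rows j + 1, ..., 1; with indices from 0,
    [tri 0] is 1. *)
Definition tri (j : nat) : nat := 'C(j.+2, 2).

(** Row [i] of a superposition of staircases, with [e j] copies of the one having j + 1 rows.
    Truncated subtraction gives 0 on rows that a staircase does not reach. *)
Definition rows (J : nat) (e : 'I_J -> nat) (i : nat) : nat :=
  (\sum_(j < J) (j.+1 - i) * e j)%N.

Definition weight (J : nat) (e : 'I_J -> nat) : nat := (\sum_(j < J) tri j * e j)%N.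

Definition second_diff (l : seq nat) (j : nat) : nat :=
  (nth 0%N l j - nth 0%N l j.+1 - (nth 0%N l j.+1 - nth 0%N l j.+2))%N.

Definition decode (J : nat) (e : 'I_J -> nat) : seq nat :=
  [seq k <- mkseq (rows e) J | 0 < k]%N.

Lemma sum_staircase (J j : nat) : (j < J)%N -> (\sum_(i < J) (j.+1 - i) = tri j)%N.
Proof.
move=> jJ; rewrite -(subnKC jJ) -(big_mkord xpredT (fun i => j.+1 - i)%N).
rewrite (big_cat_nat (n := j.+1))//= ?leq_addr//.
rewrite [X in (_ + X)%N]big_nat_cond [X in (_ + X)%N]big1 ?addn0; last first.
  by move=> i; rewrite andbT => /andP[+ _]; rewrite -subn_eq0 => /eqP.
rewrite big_nat_rev/= add0n (eq_big_nat _ _ (F2 := fun i => i.+1)); last first.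
  by move=> i /andP[_ ij]; rewrite subKn.
rewrite /tri -bin2_sum !big_mkord [RHS]big_ord_recl/= add0n.
by apply: eq_bigr.
Qed.

Lemma sum_rows (J : nat) (e : 'I_J -> nat) : (\sum_(i < J) rows e i = weight e)%N.
Proof.
rewrite exchange_big/=; apply: eq_bigr => j _.
by rewrite -big_distrl/= sum_staircase.
Qed.

Lemma sumn_nth (J : nat) (l : seq nat) : (size l <= J)%N ->
  (sumn l = \sum_(i < J) nth 0%N l i)%N.
Proof.
elim: l J => [|a l IH] [|J]//= lJ.
- by rewrite big_ord0.
- by rewrite big1// => i _; rewrite nth_nil.
- by rewrite big_ord_recl/= (IH J).
Qed.

Lemma sorted_geq_nth (l : seq nat) (i : nat) : sorted geq l ->
  (nth 0%N l i.+1 <= nth 0%N l i)%N.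
Proof.
move=> sl; have [il|li] := ltnP i.+1 (size l); last by rewrite nth_default.
by move/(sortedP 0%N): sl => /(_ i il).
Qed.

Lemma rows_second_diff (J : nat) (l : seq nat) (i : nat) : cvx l -> (size l <= J)%N ->
  rows (fun j : 'I_J => second_diff l j) i = nth 0%N l i.
Proof.
move=> [[sl _] cl] lJ; rewrite /rows.
have lmono k := sorted_geq_nth k sl.
have lcvx k : (nth 0%N l k.+1 - nth 0%N l k.+2 <= nth 0%N l k - nth 0%N l k.+1)%N.
  by have [/cl//|kl] := ltnP k.+1 (size l); rewrite (nth_default _ kl).
rewrite -(big_mkord xpredT (fun j => (j.+1 - i) * second_diff l j)%N).
have [iJ|Ji] := leqP i J; last first.
  rewrite nth_default; last by rewrite (leq_trans lJ)// ltnW.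
  rewrite big_nat_cond big1// => j; rewrite andbT => /andP[_ jJ].
  by rewrite (eqP (_ : j.+1 - i == 0)%N)// subn_eq0; lia.
(* Summation by parts twice, as a discrete Taylor expansion from [i] to [k]. Both boundary terms
   vanish at k = J, because [l] has at most [J] parts and [nth] defaults to 0. *)
suff H k : (i <= k)%N -> (\sum_(0 <= j < k) (j.+1 - i) * second_diff l j
    + (k - i) * (nth 0%N l k - nth 0%N l k.+1) + nth 0%N l k = nth 0%N l i)%N.
  by rewrite -(H J iJ) !(nth_default 0%N)// ?(leq_trans lJ)// subn0 muln0 !addn0.
elim: k => [|k IH].
  by rewrite leqn0 => /eqP ->; rewrite big_nil.
rewrite leq_eqVlt => /orP[/eqP ->|].
  rewrite subnn mul0n addn0 big_nat_cond big1// => j.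
  rewrite andbT => /andP[_ jJ].
  by rewrite (eqP (_ : j.+1 - k.+1 == 0)%N)// subn_eq0.
rewrite ltnS => ik; rewrite big_nat_recr//= -[RHS]IH// /second_diff.
have := lmono k; have := lmono k.+1; have := lcvx k.
rewrite subSn//.
move: (\sum_(_ <= _ < _) _)%N (nth _ _ _) (nth _ _ _) (nth _ _ _) (k - i)%N => S a b c d.
nia.
Qed.

Lemma nth_filter_pos (s : seq nat) (i : nat) : sorted geq s ->
  nth 0%N [seq k <- s | 0 < k]%N i = nth 0%N s i.
Proof.
elim: s i => [|a s IH] i//= pas.
have ss : sorted geq s by exact: path_sorted pas.
case: (posnP a) => [a0|a0]/=; last by case: i => [|i]//=; exact: IH.
have s0 k : nth 0%N s k = 0%N.
  elim: k => [|k IHk]; last by have := sorted_geq_nth k ss; rewrite IHk leqn0 => /eqP.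
  by case: s pas {IH ss} => //= b s /andP[+ _]; rewrite a0 leqn0 => /eqP.
by rewrite IH// s0; case: i => //= i; rewrite s0.
Qed.

Lemma rowsS (J : nat) (e : 'I_J -> nat) (i : nat) :
  (rows e i = rows e i.+1 + \sum_(j < J) (i <= j) * e j)%N.
Proof.
rewrite /rows -big_split/=; apply: eq_bigr => j _; rewrite -mulnDl; congr (_ * _)%N.
by case: leqP; lia.
Qed.

Lemma sorted_rows (J : nat) (e : 'I_J -> nat) : sorted geq (mkseq (rows e) J).
Proof.
apply/(sortedP 0%N) => i; rewrite size_mkseq => iJ.
rewrite !nth_mkseq//; last exact: ltnW.
by rewrite (rowsS e i); exact: leq_addr.
Qed.

Lemma nth_decode (J : nat) (e : 'I_J -> nat) (i : nat) :
  nth 0%N (decode e) i = rows e i.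
Proof.
rewrite nth_filter_pos ?sorted_rows//.
have [iJ|Ji] := ltnP i J; first by rewrite nth_mkseq.
rewrite nth_default ?size_mkseq// /rows big1// => j _.
by rewrite (eqP (_ : j.+1 - i == 0)%N)// subn_eq0 (leq_trans _ Ji).
Qed.

Lemma decode_convex (J : nat) (e : 'I_J -> nat) : cvx (decode e).
Proof.
split; [split|].
- apply: sorted_filter; last exact: sorted_rows.
  by move=> a b c /= ba ac; exact: leq_trans ac ba.
- exact: filter_all.
- move=> i _; rewrite !nth_decode (rowsS e i) (rowsS e i.+1) !addKn.
  by apply: leq_sum => j _; rewrite leq_mul2r; case: ltnP; lia.
Qed.

Lemma sumn_decode (J : nat) (e : 'I_J -> nat) : sumn (decode e) = weight e.
Proof.
rewrite -sum_rows (@sumn_nth J).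
  by apply: eq_bigr => i _; rewrite nth_decode.
by rewrite size_filter (leq_trans (count_size _ _))// size_mkseq.
Qed.

(** The first difference of [rows e] at [i] collects the [e j] with i <= j; a second difference
    isolates [e i]. *)
Lemma rows_inj (J : nat) (e e' : 'I_J -> nat) : rows e =1 rows e' -> e =1 e'.
Proof.
move=> ee' i.
have tail (f : 'I_J -> nat) : (\sum_(j < J) (i <= j) * f j =
    f i + \sum_(j < J) (i.+1 <= j) * f j)%N.
  rewrite (bigD1 i)//= leqnn mul1n [in RHS](bigD1 i)//= ltnn mul0n add0n.
  congr (_ + _)%N; apply: eq_bigr => j ji.
  by rewrite ltn_neqAle eq_sym -(inj_eq val_inj) in ji *; rewrite ji.
have := tail e; have := tail e'.
have := rowsS e i; have := rowsS e i.+1; have := rowsS e' i; have := rowsS e' i.+1.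
rewrite !ee'; lia.
Qed.

Lemma part_le_sumn (l : seq nat) (k : nat) : k \in l -> (k <= sumn l)%N.
Proof.
elim: l => //= a l IH; rewrite inE => /predU1P[->|/IH]; first exact: leq_addr.
by move=> /leq_trans; apply; exact: leq_addl.
Qed.

Lemma size_le_sumn (l : seq nat) : all (fun k => 0 < k)%N l -> (size l <= sumn l)%N.
Proof. by elim: l => //= a l IH /andP[a0 /IH]; rewrite -add1n; exact: leq_add. Qed.

Lemma finite_convex (n : nat) (E : set (seq nat)) : finite_set (of_size cvx n `&` E).
Proof.
apply: (@sub_finite_set _ _ (of_size cvx n)); first exact: subIsetl.
by apply: finite_of_size => l [].
Qed.

(** Second differences encode convex partitions injectively. J >= n columns suffice since there are
    at most n parts, and values below n + 1 suffice since a second difference is at most a part. *)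
Lemma convex_count_le (n J : nat) (E : set (seq nat)) (P : pred {ffun 'I_J -> 'I_n.+1}) :
  (n <= J)%N ->
  (forall l e, cvx l -> sumn l = n -> E l -> rows e =1 nth 0%N l -> weight e = n ->
     forall f : {ffun 'I_J -> 'I_n.+1}, (forall j, f j = e j :> nat) -> P f) ->
  (#|` fset_set (of_size cvx n `&` E)| <= #|P|)%N.
Proof.
move=> nJ EP.
pose enc l : {ffun 'I_J -> 'I_n.+1} := [ffun j : 'I_J => inord (second_diff l j)].
set A := fset_set _.
have AP l : l \in A -> [/\ cvx l, sumn l = n, E l & (size l <= J)%N].
  rewrite in_fset_set ?inE; last exact: finite_convex.
  move=> [[cl ln] El]; split=> //; rewrite (leq_trans _ nJ)// -ln size_le_sumn//.
  by case: cl => -[].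
have encE l j : l \in A -> enc l j = second_diff l j :> nat.
  move=> /AP[_ ln _ _]; rewrite ffunE inordK// ltnS /second_diff.
  rewrite (leq_trans (leq_subr _ _))// (leq_trans (leq_subr _ _))//.
  have [jl|lj] := ltnP j (size l); last by rewrite nth_default.
  by rewrite -ln part_le_sumn// mem_nth.
rewrite cardE -(size_map enc) uniq_leq_size//.
  rewrite map_inj_in_uniq ?fset_uniq// => l l' lA l'A ee'.
  have [cl _ _ sl] := AP _ lA; have [cl' _ _ sl'] := AP _ l'A.
  have nn i : nth 0%N l i = nth 0%N l' i.
    rewrite -(rows_second_diff i cl sl) -(rows_second_diff i cl' sl').
    by apply: eq_bigr => j _; rewrite -!encE// ee'.
  have ss m m' : cvx m -> nth 0%N m =1 nth 0%N m' -> (size m <= size m')%N.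
    move=> [[_ /allP m0] _] mm'; rewrite leqNgt; apply/negP => sm.
    by have := m0 _ (mem_nth 0%N sm); rewrite mm' nth_default.
  apply: (@eq_from_nth _ 0%N) => [|i _]; last exact: nn.
  apply/eqP; rewrite eqn_leq ss//= ss// => i; exact/esym/nn.
move=> f /mapP[l lA ->]; have [cl ln El sl] := AP _ lA; rewrite mem_enum.
have rl i := rows_second_diff i cl sl.
apply: (EP l (fun j => second_diff l j)) => //; last by move=> j; rewrite encE.
rewrite -sum_rows -ln (sumn_nth sl).
by apply: eq_bigr => i _.
Qed.

Lemma convex_count_ge (n m J K : nat) : (m <= n)%N -> (0 < J)%N ->
  (#|[pred f : {ffun 'I_J -> 'I_K} | weight (fun j => nat_of_ord (f j)) == m]|
     <= #|` fset_set (of_size cvx n)|)%N.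
Proof.
move=> mn; case: J => // J _.
(* As [tri 0] is 1, the missing n - m goes into coordinate 0. For the convex partition this only
   lengthens the largest part, which preserves convexity; the added amount is the same for all [f],
   so injectivity is kept. *)
pose up (f : {ffun 'I_J.+1 -> 'I_K}) (j : 'I_J.+1) := (f j + (j == ord0) * (n - m))%N.
have finA : finite_set (of_size cvx n) by apply: finite_of_size => l [].
rewrite cardE -(size_map (fun f => decode (up f))) uniq_leq_size//.
  rewrite map_inj_uniq ?enum_uniq// => f g fg; apply/ffunP => j; apply/val_inj.
  have : up f =1 up g by apply: rows_inj => i; rewrite -!nth_decode fg.
  by move/(_ j) => /addIn.
move=> l /mapP[f]; rewrite mem_enum inE => /eqP fm ->.
rewrite in_fset_set// inE; split; first exact: decode_convex.
rewrite sumn_decode /weight.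
under eq_bigr do rewrite mulnDr; rewrite big_split/= -/(weight _) fm.
rewrite (bigD1 ord0)//= big1 ?addn0; last by move=> i /negbTE ->; rewrite muln0.
by rewrite /tri binn !mul1n subnKC.
Qed.

(** In a nonincreasing list the entries satisfying an upward closed predicate form a prefix. The
    condition at 0 settles indices past the end, where [nth] returns 0. *)
Lemma sorted_count_gt (p : pred nat) (l : seq nat) (i : nat) :
  (forall a b, (a <= b)%N -> p a -> p b) -> ~~ p 0%N -> sorted geq l ->
  (i < count p l)%N = p (nth 0%N l i).
Proof.
move=> mp p0; elim: l i => [|a l IH] i; first by rewrite nth_nil (negbTE p0).
rewrite /= => pal; have sl : sorted geq l by exact: path_sorted pal.
case: (boolP (p a)) => pa; first by case: i => [|i]/=; rewrite ?pa// add1n ltnS IH.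
have np k : ~~ p (nth 0%N (a :: l) k).
  apply: contraNN pa; apply: mp; elim: k => // k; apply: leq_trans.
  exact: (@sorted_geq_nth (a :: l)).
have -> : count p l = 0%N; last by rewrite (negbTE (np i)).
apply/eqP; rewrite -leqn0 leqNgt -has_count; apply/hasPn => x /(nthP 0%N)[k _ <-].
exact: np k.+1.
Qed.

Lemma diagram_count (R : realType) (l : seq nat) (t : R) : is_partition l ->
  diagram l t = (count (fun k : nat => t <= k%:R) l)%:R.
Proof.
move=> [_ l0]; rewrite /diagram; congr (_%:R).
have : forall k, k \in l -> (1 <= k < (sumn l).+1)%N.
  by move=> k kl; rewrite ltnS part_le_sumn// (allP l0).
move: (sumn l).+1 => m {l0} kl.
rewrite /mult; elim: l kl => [|a l IH] kl /=; first by rewrite big1.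
rewrite big_split/= IH => [|k kin]; last by apply: kl; rewrite inE kin orbT.
congr (_ + _)%N; have am := kl a (mem_head _ _).
rewrite big_mkcond/= (bigD1_seq a)/= ?iota_uniq ?mem_index_iota// eqxx.
rewrite big1 ?addn0; first by case: ifP.
by move=> k; rewrite eq_sym => /negbTE ->; case: ifP.
Qed.

(** Conjugation of partitions: it turns events about the diagram into events about a single row, to
    which the Chernoff bound applies. *)
Lemma diagram_gt (R : realType) (l : seq nat) (t : R) (i : nat) : is_partition l -> 0 < t ->
  (i%:R < diagram l t) = (t <= (nth 0%N l i)%:R).
Proof.
move=> pl t0; rewrite diagram_count// ltr_nat.
apply: (@sorted_count_gt (fun k : nat => t <= k%:R)); last by case: pl.
  by move=> a b ab /le_trans; apply; rewrite ler_nat.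
by rewrite -ltNge.
Qed.

(** * Gaussian integrals *)

(** Tonelli on a planar region described by its vertical and by its horizontal sections; it serves
    both for triangles x < y and for the region under the limit shape. *)
Lemma tonelli_section (R : realType) (A : set (R * R)) (f : R * R -> \bar R) (D E : set R)
    (U V : R -> set R) :
  measurable A -> measurable_fun setT f -> (forall z, A z -> (0 <= f z)%E) ->
  (forall x y, A (x, y) <-> D x /\ U x y) -> (forall x y, A (x, y) <-> E y /\ V y x) ->
  (\int[lebesgue_measure]_(x in D) \int[lebesgue_measure]_(y in U x) f (x, y) =
   \int[lebesgue_measure]_(y in E) \int[lebesgue_measure]_(x in V y) f (x, y))%E.
Proof.
move=> mA mf f0 DU EV.
pose g := f \_ A.
have mg : measurable_fun setT g.
  by apply/(measurable_restrictT _ mA); exact: measurable_funTS.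
have g0 z : (0 <= g z)%E by apply: erestrict_ge0 => ? ?; exact: f0.
have := fubini_tonelli (m1 := lebesgue_measure) (m2 := lebesgue_measure) g mg g0.
rewrite /fubini_F /fubini_G => gg.
rewrite integral_mkcond [RHS]integral_mkcond.
transitivity (\int[lebesgue_measure]_x \int[lebesgue_measure]_y g (x, y))%E.
  apply: eq_integral => x _; rewrite patchE; case: ifPn => [|xD].
    rewrite inE => xD; rewrite integral_mkcond; apply: eq_integral => y _.
    rewrite /g !patchE; congr (if _ then _ else _).
    apply/idP/idP; rewrite !inE; first by move=> Uy; apply/DU.
    by move=> /DU[].
  rewrite integral0_eq// => y _; rewrite /g patchE ifN//.
  by apply: contra xD; rewrite !inE => /DU[].
rewrite gg; apply: eq_integral => y _; rewrite patchE; case: ifPn => [|yE].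
  rewrite inE => yE; rewrite [RHS]integral_mkcond; apply: eq_integral => x _.
  rewrite /g !patchE; congr (if _ then _ else _).
  apply/idP/idP; rewrite !inE; last by move=> Vx; apply/EV.
  by move=> /EV[].
rewrite integral0_eq// => x _; rewrite /g patchE ifN//.
by apply: contra yE; rewrite !inE => /EV[].
Qed.

Lemma tonelli_triangle (R : realType) (f : R * R -> \bar R) :
  measurable_fun setT f -> (forall x y, 0 < x -> x < y -> (0 <= f (x, y))%E) ->
  (\int[lebesgue_measure]_(x in `]0%R, +oo[) \int[lebesgue_measure]_(y in `]x, +oo[) f (x, y) =
   \int[lebesgue_measure]_(y in `]0%R, +oo[) \int[lebesgue_measure]_(x in `]0%R, y[) f (x, y))%E.
Proof.
move=> mf f0.
pose A : set (R * R) := [set z | 0 < z.1 /\ z.1 < z.2].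
have mA : measurable A.
  have -> : A = ((fst : (R * R) -> R) @^-1` `]0, +oo[) `&`
                ((fun z : R * R => z.2 - z.1) @^-1` `]0, +oo[).
    apply/seteqP; split => [[x y]|[x y]] /=; rewrite !in_itv/= !andbT subr_gt0//.
  apply: measurableI; rewrite -[X in measurable X]setTI.
    exact: measurable_fst.
  by apply: measurable_funB => //; exact: measurable_snd.
apply: (tonelli_section (A := A)) => //.
- by move=> [x y] [/= x0 xy]; exact: f0.
- by move=> x y; rewrite /A/= !in_itv/= !andbT.
- move=> x y; rewrite /A/= !in_itv/= !andbT; split=> [[x0 xy]|[_ /andP[]]]//.
  by rewrite x0 xy (lt_trans x0).
Qed.

Lemma is_derive_expR_sq (R : realType) (a x : R) :
  is_derive x 1 (fun y => expR (- (a / 2 * y ^+ 2))) (- (a * x) * expR (- (a / 2 * x ^+ 2))).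
Proof.
by apply: is_derive_eq; rewrite /GRing.scale/=; field.
Qed.

Lemma continuous_expR_sq (R : realType) (a : R) :
  continuous (fun y : R => expR (- (a / 2 * y ^+ 2))).
Proof.
move=> y; apply: differentiable_continuous; apply/derivable1_diffP.
by have := is_derive_expR_sq a y; case.
Qed.

Lemma cvg_sqr_pinfty (R : realType) (a : R) : 0 < a ->
  (a / 2 * y ^+ 2) @[y --> +oo] --> +oo.
Proof.
move=> a0; apply/cvgryPge => M; near=> y.
have y1 : 1 <= y by near: y; apply: nbhs_pinfty_ge; exact: num_real.
have My : M / (a / 2) <= y by near: y; apply: nbhs_pinfty_ge; exact: num_real.
by rewrite mulrC -ler_pdivrMr ?divr_gt0// (le_trans My)// expr2 ler_peMr.
Unshelve. all: by end_near. Qed.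

Lemma cvg_expR_sq (R : realType) (a : R) : 0 < a ->
  expR (- (a / 2 * y ^+ 2)) @[y --> +oo] --> (0 : R).
Proof.
by move=> a0; apply: (@cvg_comp _ _ _ _ (fun u => expR (- u)) _ _ _ (cvg_sqr_pinfty a0)
  (@cvgr_expR R)).
Qed.

Lemma integral_tail_gauss (R : realType) (a x : R) : 0 < a -> 0 < x ->
  (\int[lebesgue_measure]_(y in `]x, +oo[) (a * y * expR (- (a / 2 * y ^+ 2)))%:E =
   (expR (- (a / 2 * x ^+ 2)))%:E)%E.
Proof.
move=> a0 x0.
have cE := @continuous_expR_sq R a.
have cf : continuous (fun y : R => a * y * expR (- (a / 2 * y ^+ 2))).
  move=> y; apply: cvgM; last exact: cE.
  by apply: cvgM; [exact: cvg_cst|exact: cvg_id].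
rewrite integral_itv_obnd_cbnd; last first.
  by apply/measurable_EFinP/measurable_funTS; exact: continuous_measurable_fun.
rewrite (@ge0_continuous_FTC2y _ _ (fun y => - expR (- (a / 2 * y ^+ 2))) x 0).
- by rewrite -EFinB opprK add0r.
- move=> y xy; rewrite !mulr_ge0 ?expR_ge0 ?(ltW a0)//.
  by rewrite (le_trans (ltW x0)).
- exact: continuous_subspaceT.
- by rewrite -[X in _ --> X]oppr0; apply: cvgN; exact: cvg_expR_sq.
- by move=> y _; apply: derivableN; case: (is_derive_expR_sq a y).
- by apply: cvg_at_right_filter; apply: cvgN; exact: cE.
- move=> y _; rewrite derive1E deriveN; last by case: (is_derive_expR_sq a y).
  by have [_ ->] := is_derive_expR_sq a y; rewrite mulNr opprK.
Qed.

Lemma integral_gauss_scaled (R : realType) (a : R) : 0 < a ->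
  (\int[lebesgue_measure]_(y in `]0%R, +oo[) (expR (- (a / 2 * y ^+ 2)))%:E =
   (Num.sqrt (pi / 2) * (a `^ 2^-1)^-1)%:E)%E.
Proof.
move=> a0.
pose s := Num.sqrt (a / 2).
have s0 : 0 < s by rewrite sqrtr_gt0 divr_gt0.
have s2 : s ^+ 2 = a / 2 by rewrite sqr_sqrtr// ltW// divr_gt0.
have dF : (fun x : R => s * x)^`()%classic = cst s.
  by apply/funext => x; rewrite derive1E deriveM// derive_cst scaler0 addr0 derive_id;
    rewrite /GRing.scale/= mulr1.
have cE := @continuous_expR_sq R a.
have := @increasing_ge0_integration_by_substitutiony R (fun x => s * x) (@gauss_fun R) 0.
rewrite mulr0 integral0y_gauss dF => H.
rewrite integral_itv_obnd_cbnd; last first.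
  by apply/measurable_EFinP/measurable_funTS; exact: continuous_measurable_fun.
have {}H : ((Num.sqrt pi / 2)%:E =
    \int[lebesgue_measure]_(x in `[0%R, +oo[) (s%:E * (expR (- (a / 2 * x ^+ 2)))%:E))%E.
  rewrite H.
  - apply: eq_integral => x _.
    by rewrite -s2 -exprMn -EFinM (mulrC s (expR _)).
  - by move=> x y _ _ xy; rewrite ltr_pM2l.
  - by move=> x _; exact: cvg_cst.
  - exact: is_cvg_cst.
  - exact: is_cvg_cst.
  - split=> [x _|]; first by [].
    by apply: cvg_at_right_filter; apply: cvgM; [exact: cvg_cst|exact: cvg_id].
  - apply/cvgryPge => M; exists (M / s); split=> [|x Mx]; first exact: num_real.
    by rewrite mulrC -ler_pdivrMr// ltW.
  - by apply: continuous_subspaceT; exact: continuous_gauss_fun.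
  - by move=> x _; exact: gauss_fun_ge0.
rewrite ge0_integralZl_EFin// in H; last 2 first.
- by apply/measurable_EFinP/measurable_funTS; exact: continuous_measurable_fun.
- exact: ltW.
have -> : (Num.sqrt (pi / 2) * (a `^ 2^-1)^-1 = s^-1 * (Num.sqrt pi / 2) :> R).
  rewrite -powR12_sqrt ?divr_ge0 ?pi_ge0// /s -!powR12_sqrt ?pi_ge0 ?divr_ge0 ?(ltW a0)//.
  rewrite !powRM ?pi_ge0 ?invr_ge0 ?(ltW a0)//.
  have h0 : (2^-1 : R) `^ 2^-1 != 0 by rewrite gt_eqF// powR_gt0.
  have ha : a `^ 2^-1 != 0 by rewrite gt_eqF// powR_gt0.
  have h2 : ((2^-1 : R) `^ 2^-1) * ((2^-1 : R) `^ 2^-1) = 2^-1.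
    rewrite -powRD; last by rewrite gt_eqF// implybT.
    by rewrite -[X in _ `^ X](_ : 1 = _) ?powRr1//; field.
  move: h0 ha h2; move: (2^-1 `^ 2^-1) (a `^ 2^-1) (pi `^ 2^-1) => k A P k0 A0 k2.
  by rewrite -k2; field; rewrite k0 A0.
by rewrite EFinM H muleA -EFinM mulVf ?gt_eqF// mul1e.
Qed.

Lemma integral_itv_cst (R : realType) (x y r : R) (a b : bool) : x <= y ->
  (\int[lebesgue_measure]_(_ in [set` Interval (BSide a x) (BSide b y)]) r%:E =
   (r * (y - x))%:E)%E.
Proof.
move=> xy; rewrite integral_cst//= lebesgue_measure_itv/= lte_fin; case: ltP => [_|yx].
  by rewrite -EFinB -EFinM.
by rewrite mule0 (_ : y - x = 0) ?mulr0//; apply/eqP; rewrite subr_eq0 eq_le xy yx.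
Qed.

(** Replaces integration by parts by Tonelli: exp (- a x^2 / 2) is the integral of a y exp (- a y^2
    / 2) over y > x, and exchanging the order makes the zeroth Gaussian moment equal to a times the
    second. *)
Lemma integral_sqr_gauss (R : realType) (a : R) : 0 < a ->
  (\int[lebesgue_measure]_(y in `]0%R, +oo[) (y ^+ 2 * expR (- (a / 2 * y ^+ 2)))%:E =
   (Num.sqrt (pi / 2) * (a `^ (3 / 2))^-1)%:E)%E.
Proof.
move=> a0.
have cE := @continuous_expR_sq R a.
have mE := continuous_measurable_fun cE.
have mf : measurable_fun setT (fun z : R * R => (a * z.2 * expR (- (a / 2 * z.2 ^+ 2)))%:E).
  apply/measurable_EFinP.
  apply: (@measurableT_comp _ _ _ _ _ _ (fun y : R => a * y * expR (- (a / 2 * y ^+ 2)))).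
    by apply: measurable_funM => //; exact: measurable_funM.
  exact: measurable_snd.
have := tonelli_triangle mf.
rewrite /= => H.
have {}H : (\int[lebesgue_measure]_(x in `]0%R, +oo[) (expR (- (a / 2 * x ^+ 2)))%:E =
  \int[lebesgue_measure]_(y in `]0%R, +oo[) (a%:E * (y ^+ 2 * expR (- (a / 2 * y ^+ 2)))%:E))%E.
  transitivity (\int[lebesgue_measure]_(x in `]0%R, +oo[)
     \int[lebesgue_measure]_(y in `]x, +oo[) (a * y * expR (- (a / 2 * y ^+ 2)))%:E)%E.
    apply: eq_integral => x; rewrite inE/= in_itv/= andbT => x0.
    by rewrite integral_tail_gauss.
  rewrite H; last first.
    move=> x y x0 xy /=; rewrite lee_fin; apply: mulr_ge0; last exact: expR_ge0.
    by apply: mulr_ge0; [exact: ltW|exact: ltW (lt_trans x0 xy)].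
  apply: eq_integral => y; rewrite inE/= in_itv/= andbT => y0.
  rewrite (integral_itv_cst (a * y * expR (- (a / 2 * y ^+ 2))) false true (ltW y0)).
  by rewrite -EFinM; congr EFin; ring.
rewrite integral_gauss_scaled// ge0_integralZl_EFin// in H; last 3 first.
- by move=> y _; rewrite lee_fin mulr_ge0 ?sqr_ge0 ?expR_ge0.
- by apply/measurable_EFinP/measurable_funTS; apply: measurable_funM => //; exact: measurable_funX.
- exact: ltW.
have -> : (a `^ (3 / 2))^-1 = a^-1 * (a `^ 2^-1)^-1.
  rewrite -invfM -{2}(powRr1 (ltW a0)) -powRD; last by rewrite gt_eqF// implybT.
  by congr (_ `^ _)^-1; field.
by rewrite mulrCA EFinM H muleA -EFinM mulVf ?gt_eqF// mul1e.
Qed.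

(** * The Bose integrand and its normalization *)

Lemma powR32 (R : realType) (x : R) : 0 <= x -> x `^ (3 / 2) = x * Num.sqrt x.
Proof.
move=> x0; rewrite -powR12_sqrt// -{2}(powRr1 x0) -powRD.
  by congr (_ `^ _); field.
by rewrite (_ : 1 + 2^-1 == 0 = false)//; apply: gt_eqF; lra.
Qed.

Lemma is_cvg_riemannR32 (R : realType) : cvgn (series (riemannR (3 / 2 : R))).
Proof.
have r0 k : 0 <= riemannR (3 / 2 : R) k.
  by rewrite ltW// riemannR_gt0// divr_ge0.
apply: nondecreasing_is_cvgn.
  by apply/nondecreasing_seqP => n; rewrite /series/= big_nat_recr//= lerDl r0.
(* Comparison with the integral of x^(-3/2), in telescoping form; 3 is the value that makes the
   first term an equality. *)
suff H n : series (riemannR (3 / 2 : R)) n.+1 <= 3 - 2 / Num.sqrt n.+1%:R.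
  exists 3 => _ [n _ <-]; case: n => [|n]; first by rewrite /series/= big_geq.
  by rewrite (le_trans (H n))// gerBl divr_ge0// sqrtr_ge0.
elim: n => [|n IH].
  by rewrite /series/= big_nat1 /riemannR powR1 sqrtr1; lra.
rewrite /series/= big_nat_recr//=; apply: le_trans (lerD IH (lexx _)) _.
rewrite /riemannR powR32//.
have s0 m : 0 < Num.sqrt (m.+1%:R : R) by rewrite sqrtr_gt0.
have s2 m : Num.sqrt (m.+1%:R : R) ^+ 2 = m.+1%:R by rewrite sqr_sqrtr.
have ab : Num.sqrt (n.+2%:R : R) ^+ 2 = Num.sqrt (n.+1%:R : R) ^+ 2 + 1.
  by rewrite !s2 -natr1.
move: (s0 n) (s0 n.+1) ab (s2 n.+1).
move: (Num.sqrt n.+1%:R) (Num.sqrt n.+2%:R) => a b a0 b0 ab <-.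
rewrite -subr_ge0.
have ba : b - a = (a + b)^-1.
  by apply: (mulIf (x := a + b)); rewrite ?mulVf ?gt_eqF ?addr_gt0//; lra.
have -> : 3 - 2 / b - (3 - 2 / a + (b ^+ 2 * b)^-1) = (2 * (b - a) / (a * b) - (b ^+ 2 * b)^-1).
  by field; rewrite !gt_eqF.
rewrite ba.
have -> : 2 * (a + b)^-1 / (a * b) - (b ^+ 2 * b)^-1 =
   (2 * b ^+ 2 - a * (a + b)) / ((a + b) * a * b ^+ 3).
  by field; rewrite !gt_eqF ?addr_gt0.
rewrite divr_ge0//; last by rewrite !mulr_ge0 ?exprn_ge0 ?addr_ge0 ?ltW.
have : a <= b by rewrite -subr_ge0 ba invr_ge0 addr_ge0 ?ltW.
move=> h; have -> : 2 * b ^+ 2 - a * (a + b) = (b - a) * (2 * b + a) by ring.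
by rewrite mulr_ge0; lra.
Qed.

Lemma nonincreasing_pos_measurable (R : realType) (f : R -> R) :
  (forall x y, 0 < x -> x <= y -> f y <= f x) -> measurable_fun (`]0, +oo[%classic : set R) f.
Proof.
move=> f_ni; apply: (measurability (@RGenCInfty.G R)) => [|/= _ [_] [r] -> <-].
  exact: RGenCInfty.measurableE.
apply: is_interval_measurable => s t/=.
rewrite !in_itv/= !andbT => -[s0 fs] [t0 ft] u /andP[su ut].
have u0 := lt_le_trans s0 su.
by rewrite /= !in_itv/= !andbT; split=> //; rewrite (le_trans ft)// f_ni.
Qed.

(** Scaling limit of the mean occupation [bose] of column j, with y = j h. The value 0 off the
    positive axis makes it nonnegative and measurable on the whole line. *)
Definition gam (R : realType) (c y : R) : R :=
  if 0 < y then bose (c * 2^-1 * y ^+ 2) else 0.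

Section GamTheory.
Context (R : realType) (c : R) (c0 : 0 < c).
Local Notation mu := (@lebesgue_measure R).

Lemma half_sq_gt0 (y : R) : 0 < y -> 0 < c * 2^-1 * y ^+ 2.
Proof. by move=> y0; rewrite !mulr_gt0 ?exprn_gt0. Qed.

Lemma gamE (y : R) : 0 < y -> gam c y = bose (c * 2^-1 * y ^+ 2).
Proof. by rewrite /gam => ->. Qed.

Lemma gam_gt0 (y : R) : 0 < y -> 0 < gam c y.
Proof. by move=> y0; rewrite gamE// bose_gt0// half_sq_gt0. Qed.

Lemma gam_ge0 (y : R) : 0 <= gam c y.
Proof. by have [y0|/negbTE] := boolP (0 < y); [rewrite ltW// gam_gt0|rewrite /gam => ->]. Qed.

Lemma gam_le (y z : R) : 0 < y -> y <= z -> gam c z <= gam c y.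
Proof.
move=> y0 yz; have z0 := lt_le_trans y0 yz.
rewrite !gamE// bose_le ?half_sq_gt0//.
by rewrite ler_pM2l ?mulr_gt0// lerXn2r ?nnegrE// ltW.
Qed.

Lemma mgam : measurable_fun setT (gam c).
Proof.
have -> : gam c = (gam c) \_ `]0, +oo[.
  by apply/funext => y; rewrite patchE mem_setE in_itv/= andbT /gam; case: ifP.
apply/(measurable_restrictT _ (measurable_itv _)).
by apply: nonincreasing_pos_measurable => y z; exact: gam_le.
Qed.

Lemma gam_series (y : R) : 0 < y ->
  ((y ^+ 2 / 2 * gam c y)%:E =
   \sum_(k <oo) (2^-1 * (y ^+ 2 * expR (- (k.+1%:R * c / 2 * y ^+ 2))))%:E)%E.
Proof.
move=> y0; apply/esym/cvg_lim => //.
set u := c * 2^-1 * y ^+ 2; have u0 : 0 < u by exact: half_sq_gt0.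
have z1 : `|expR (- u)| < 1 by rewrite gtr0_norm ?expR_gt0// expR_lt1 oppr_lt0.
have := @cvg_geometric_series R (y ^+ 2 / 2 * expR (- u)) _ z1.
rewrite -(mulrA _ (expR (- u))) -/(bose u) -(gamE y0) => H.
under eq_fun do rewrite sumEFin.
apply: cvg_EFin; first exact: nearW.
apply: cvg_trans H; apply: near_eq_cvg; apply: nearW => n /=.
rewrite /series/=; apply: eq_bigr => k _ /=.
have -> : - (k.+1%:R * c / 2 * y ^+ 2) = k.+1%:R * (- u) by rewrite /u; ring.
rewrite expRM_natl; move: (expR (- u)) (y ^+ 2) => E Y.
by rewrite exprS !mulrA (mulrC Y).
Qed.

(** Expanding [bose] as a geometric series gives Gaussians of parameter (k + 1) c; each second
    moment carries (k + 1)^(-3/2), and these sum to zeta (3/2). *)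
Lemma integral_sqr_gam :
  (\int[mu]_(y in `]0%R, +oo[) (y ^+ 2 / 2 * gam c y)%:E =
   (2^-1 * (Num.sqrt (pi / 2) * (c `^ (3 / 2))^-1) * zeta (3 / 2))%:E)%E.
Proof.
transitivity (\int[mu]_(y in `]0%R, +oo[)
   (\sum_(k <oo) (2^-1 * (y ^+ 2 * expR (- (k.+1%:R * c / 2 * y ^+ 2))))%:E))%E.
  by apply: eq_integral => y; rewrite inE/= in_itv/= andbT => y0; exact: gam_series.
have mE k : measurable_fun setT (fun y : R => y ^+ 2 * expR (- (k.+1%:R * c / 2 * y ^+ 2))).
  apply: continuous_measurable_fun => y; apply: cvgM; first exact: exprn_continuous.
  exact: continuous_expR_sq.
rewrite integral_nneseries//; last 2 first.
- by move=> k; apply/measurable_EFinP/measurable_funTS; apply: measurable_funM => //; exact: mE.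
- by move=> k y _; rewrite lee_fin mulr_ge0 ?invr_ge0// mulr_ge0 ?sqr_ge0 ?expR_ge0.
apply/cvg_lim => //.
set K := 2^-1 * _.
have H : K * series (riemannR (3 / 2)) n @[n --> \oo] --> K * zeta (3 / 2 : R).
  by apply: cvgM; [exact: cvg_cst|exact: is_cvg_riemannR32].
rewrite (_ : (fun _ => _) = fun n => (K * series (riemannR (3 / 2)) n)%:E).
  by apply: cvg_EFin => //; exact: nearW.
apply/funext => n.
rewrite /series/= mulr_sumr -sumEFin; apply: eq_bigr => k _ /=.
under eq_integral do rewrite EFinM.
rewrite ge0_integralZl_EFin//; last 2 first.
- by move=> y _; rewrite lee_fin mulr_ge0 ?sqr_ge0 ?expR_ge0.
- by apply/measurable_EFinP/measurable_funTS; exact: mE.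
rewrite integral_sqr_gauss ?mulr_gt0// -EFinM; congr EFin.
by rewrite /K /riemannR powRM ?(ltW c0)// invfM (mulrC (_ `^ _)^-1) !mulrA.
Qed.
End GamTheory.

Lemma zeta32_gt0 (R : realType) : 0 < zeta (3 / 2 : R).
Proof.
apply: (@lt_le_trans _ _ (series (riemannR (3 / 2 : R)) 1)).
  by rewrite /series/= big_nat1 /riemannR powR1 invr1.
apply: nondecreasing_cvgn_le; last exact: is_cvg_riemannR32.
apply/nondecreasing_seqP => n; rewrite /series/= big_nat_recr//= lerDl.
by rewrite invr_ge0 powR_ge0.
Qed.

Lemma convex_const_gt0 (R : realType) : 0 < convex_const R.
Proof. by rewrite /convex_const !mulr_gt0 ?powR_gt0 ?pi_gt0 ?zeta32_gt0. Qed.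

(** This equation is the origin of the constant c: it says that the Boltzmann mean size at mesh h is
    asymptotically h^(-3), that is n. The same integral is the total mass of the limit shape. *)
Lemma convex_const_normalizes (R : realType) :
  (\int[lebesgue_measure]_(y in `]0%R, +oo[) (y ^+ 2 / 2 * gam (convex_const R) y)%:E = 1)%E.
Proof.
have c0 := convex_const_gt0 R.
rewrite integral_sqr_gam//; congr EFin.
have z0 := zeta32_gt0 R; have p0 := pi_gt0 R.
have -> : convex_const R `^ (3 / 2) = (2^-1) `^ (3 / 2) * Num.sqrt pi * zeta (3 / 2).
  rewrite /convex_const !powRM ?mulr_ge0 ?powR_ge0 ?invr_ge0// -!powRrM.
  rewrite -powR12_sqrt ?(ltW p0)//.
  have -> : 3^-1 * (3 / 2) = 2^-1 :> R by field.
  have -> : 2 / 3 * (3 / 2) = 1 :> R by field.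
  by rewrite (powRr1 (ltW z0)).
rewrite powR32 ?invr_ge0// sqrtrM ?(ltW p0)//.
have : Num.sqrt (2^-1 : R) != 0 by rewrite gt_eqF// sqrtr_gt0 invr_gt0.
have : Num.sqrt (pi : R) != 0 by rewrite gt_eqF// sqrtr_gt0.
move: z0; move: (Num.sqrt pi) (Num.sqrt 2^-1) (zeta (3 / 2)) => P h z z0 P0 h0.
by field; rewrite P0 h0 gt_eqF.
Qed.

(** * The inverse limit shape *)

(** Minus the derivative of [tail1 c], which is the function C^(-1) of the theorem. In both
    definitions [fine] loses nothing for x > 0, where the integrals are finite. *)
Definition tail0 (R : realType) (c x : R) : R :=
  fine (\int[lebesgue_measure]_(y in `]x, +oo[) (gam c y)%:E)%E.

Definition tail1 (R : realType) (c x : R) : R :=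
  fine (\int[lebesgue_measure]_(y in `]x, +oo[) ((y - x) * gam c y)%:E)%E.

Section Tails.
Context (R : realType) (c : R) (c0 : 0 < c).
Local Notation mu := (@lebesgue_measure R).
Context (norm1 : (\int[mu]_(y in `]0%R, +oo[) (y ^+ 2 / 2 * gam c y)%:E = 1)%E).

Lemma mlin (x : R) : measurable_fun setT (fun y : R => (y - x) * gam c y).
Proof. by apply: measurable_funM; [exact: measurable_funB|exact: mgam]. Qed.

Lemma msqr_gam : measurable_fun setT (fun y : R => y ^+ 2 / 2 * gam c y).
Proof.
apply: measurable_funM; last exact: mgam.
by apply: measurable_funM => //; exact: measurable_funX.
Qed.

(** The normalized density y^2 / 2 times [gam] is the common dominating function for the tails: a
    pointwise factor [k] becomes the bound on the integral. *)
Lemma integral_tail_le (x k : R) (f : R -> R) : 0 < x -> 0 <= k ->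
  measurable_fun setT f ->
  (forall y, x < y -> 0 <= f y <= k * (y ^+ 2 / 2 * gam c y)) ->
  (0 <= \int[mu]_(y in `]x, +oo[) (f y)%:E <= k%:E)%E.
Proof.
move=> x0 k0 mf fk; apply/andP; split.
  apply: integral_ge0 => y; rewrite /= in_itv/= andbT => /fk/andP[f0 _].
  by rewrite lee_fin.
have s0 y : (0 <= (y ^+ 2 / 2 * gam c y)%:E)%E.
  by rewrite lee_fin mulr_ge0 ?gam_ge0// divr_ge0 ?sqr_ge0.
rewrite (@le_trans _ _ (\int[mu]_(y in `]x, +oo[) (k%:E * (y ^+ 2 / 2 * gam c y)%:E))%E)//.
  apply: ge0_le_integral => //.
  - by move=> y; rewrite /= in_itv/= andbT => /fk/andP[]; rewrite lee_fin.
  - by apply/measurable_EFinP/measurable_funTS.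
  - apply/measurable_EFinP/measurable_funTS.
    by apply: measurable_funM => //; exact: msqr_gam.
  - by move=> y; rewrite /= in_itv/= andbT => /fk/andP[_]; rewrite lee_fin.
rewrite ge0_integralZl_EFin//; last first.
  by apply/measurable_EFinP/measurable_funTS; exact: msqr_gam.
rewrite -[leRHS]mule1 -norm1 lee_wpmul2l ?lee_fin//.
apply: ge0_subset_integral => //.
  by apply/measurable_EFinP/measurable_funTS; exact: msqr_gam.
by apply: subset_itvr; rewrite bnd_simp ltW.
Qed.

Lemma fineK_le (u : \bar R) (k : R) : (0 <= u <= k%:E)%E -> ((fine u)%:E = u)%E.
Proof.
move=> /andP[u0 uk]; apply: fineK; rewrite ge0_fin_numE//.
exact: le_lt_trans uk (ltry _).
Qed.

Lemma gam_tail_le (x : R) : 0 < x ->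
  (0 <= \int[mu]_(y in `]x, +oo[) (gam c y)%:E <= (2 / x ^+ 2)%:E)%E.
Proof.
move=> x0; apply: integral_tail_le => //; first by rewrite divr_ge0 ?sqr_ge0.
  exact: mgam.
move=> y xy; rewrite gam_ge0//= mulrA -[leLHS]mul1r ler_wpM2r ?gam_ge0//.
have -> : 2 / x ^+ 2 * (y ^+ 2 / 2) = y ^+ 2 / x ^+ 2 by field; rewrite gt_eqF.
rewrite ler_pdivlMr ?exprn_gt0// mul1r.
by rewrite lerXn2r ?nnegrE// ltW// (lt_trans x0).
Qed.

Lemma lin_tail_le (x : R) : 0 < x ->
  (0 <= \int[mu]_(y in `]x, +oo[) ((y - x) * gam c y)%:E <= (2 / x)%:E)%E.
Proof.
move=> x0; apply: integral_tail_le => //; first by rewrite divr_ge0 ?ltW.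
  exact: mlin.
move=> y xy; apply/andP; split; first by rewrite mulr_ge0 ?gam_ge0// subr_ge0 ltW.
rewrite mulrA ler_wpM2r ?gam_ge0//.
have -> : 2 / x * (y ^+ 2 / 2) = y ^+ 2 / x by field; rewrite gt_eqF.
rewrite ler_pdivlMr//.
have : 0 <= (y - x) ^+ 2 by rewrite sqr_ge0.
have : 0 < x * y by rewrite mulr_gt0// (lt_trans x0).
lra.
Qed.

Lemma tail0E (x : R) : 0 < x ->
  ((tail0 c x)%:E = \int[mu]_(y in `]x, +oo[) (gam c y)%:E)%E.
Proof. by move=> x0; exact: fineK_le (gam_tail_le x0). Qed.

Lemma tail1E (x : R) : 0 < x ->
  ((tail1 c x)%:E = \int[mu]_(y in `]x, +oo[) ((y - x) * gam c y)%:E)%E.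
Proof. by move=> x0; exact: fineK_le (lin_tail_le x0). Qed.

Lemma tail1_le (x : R) : 0 < x -> tail1 c x <= 2 / x.
Proof. by move=> x0; rewrite -lee_fin tail1E//; case/andP: (lin_tail_le x0). Qed.

Lemma tail0_ge (x d : R) : 0 < x -> 0 <= d -> d * gam c (x + d) <= tail0 c x.
Proof.
move=> x0 d0; rewrite -lee_fin tail0E//.
have xd : x <= x + d by rewrite lerDl.
have <- : (\int[mu]_(y in `]x, (x + d)%R]) (gam c (x + d))%:E)%E = (d * gam c (x + d))%:E.
  by rewrite (integral_itv_cst _ false false xd) mulrC addrAC subrr add0r.
apply: (@le_trans _ _ (\int[mu]_(y in `]x, (x + d)%R]) (gam c y)%:E)%E).
  apply: ge0_le_integral => //.
  - by move=> y _; rewrite lee_fin gam_ge0.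
  - by apply/measurable_EFinP/measurable_funTS; exact: mgam.
  - move=> y; rewrite /= in_itv/= => /andP[xy yd].
    by rewrite lee_fin gam_le// (lt_trans x0).
apply: ge0_subset_integral => //.
- by apply/measurable_EFinP/measurable_funTS; exact: mgam.
- by move=> y _; rewrite lee_fin gam_ge0.
- by apply: subset_itvl.
Qed.

Lemma tail0_gt0 (x : R) : 0 < x -> 0 < tail0 c x.
Proof.
move=> x0; apply: lt_le_trans (tail0_ge x0 ler01).
by rewrite mul1r gam_gt0// addr_gt0.
Qed.

(** On y > z write y - x = (y - z) + (z - x), and drop the nonnegative contribution of y between x
    and z. *)
Lemma tail1_ge (x z : R) : 0 < x -> x <= z ->
  tail1 c z + (z - x) * tail0 c z <= tail1 c x.
Proof.
move=> x0 xz; have z0 := lt_le_trans x0 xz.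
have zx0 : 0 <= z - x by rewrite subr_ge0.
rewrite -lee_fin EFinD EFinM !tail1E// tail0E//.
rewrite -ge0_integralZl_EFin//; last 2 first.
- by move=> y _; rewrite lee_fin gam_ge0.
- by apply/measurable_EFinP/measurable_funTS; exact: mgam.
rewrite -ge0_integralD//; last 4 first.
- move=> y; rewrite /= in_itv/= andbT => zy.
  by rewrite lee_fin mulr_ge0 ?gam_ge0// subr_ge0 ltW.
- by apply/measurable_EFinP/measurable_funTS; exact: mlin.
- by move=> y _; rewrite mule_ge0 ?lee_fin ?gam_ge0.
- apply/measurable_EFinP/measurable_funTS.
  by apply: measurable_funM => //; exact: mgam.
rewrite (@le_trans _ _ (\int[mu]_(y in `]z, +oo[) ((y - x) * gam c y)%:E)%E)//.
  rewrite le_eqVlt; apply/orP; left; apply/eqP; apply: eq_integral => y _.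
  by rewrite -EFinM -EFinD; congr EFin; ring.
apply: ge0_subset_integral => //.
- by apply/measurable_EFinP/measurable_funTS; exact: mlin.
- move=> y; rewrite /= in_itv/= andbT => xy.
  by rewrite lee_fin mulr_ge0 ?gam_ge0// subr_ge0 ltW.
- by apply: subset_itvr; rewrite bnd_simp.
Qed.

(** On y > x one has y - x <= max (y - z) 0 + (z - x). With [tail1_ge] this brackets the slopes of
    [tail1 c], giving strict decrease and continuity. *)
Lemma tail1_lip (x z : R) : 0 < x -> x <= z ->
  tail1 c x <= tail1 c z + (z - x) * tail0 c x.
Proof.
move=> x0 xz; have z0 := lt_le_trans x0 xz.
have zx0 : 0 <= z - x by rewrite subr_ge0.
rewrite -lee_fin EFinD EFinM !tail1E// tail0E//.
have -> : (\int[mu]_(y in `]z, +oo[) ((y - z) * gam c y)%:E =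
   \int[mu]_(y in `]x, +oo[) ((fun y => ((y - z) * gam c y)%:E) \_ `]z, +oo[) y)%E.
  rewrite -integral_mkcondr; congr integral.
  apply/seteqP; split=> y /=; rewrite !in_itv/= !andbT; last by case.
  by move=> zy; split=> //; exact: le_lt_trans zy.
have lin0 y : y \in `]z, +oo[%classic -> (0 <= ((y - z) * gam c y)%:E)%E.
  rewrite inE/= in_itv/= andbT => zy.
  by rewrite lee_fin mulr_ge0 ?gam_ge0// subr_ge0 ltW.
have mz : measurable_fun setT ((fun y => ((y - z) * gam c y)%:E) \_ `]z, +oo[%classic).
  apply/(measurable_restrictT _ (measurable_itv _)).
  by apply/measurable_EFinP/measurable_funTS; exact: mlin.
have p0 y : (0 <= ((fun y => ((y - z) * gam c y)%:E) \_ `]z, +oo[) y)%E.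
  by rewrite patchE; case: ifP => // /lin0.
rewrite -ge0_integralZl_EFin//; last 2 first.
- by move=> y _; rewrite lee_fin gam_ge0.
- by apply/measurable_EFinP/measurable_funTS; exact: mgam.
have mg : measurable_fun setT (fun y : R => ((z - x)%:E * (gam c y)%:E)%E).
  by apply/measurable_EFinP; apply: measurable_funM => //; exact: mgam.
rewrite -ge0_integralD//; last 3 first.
- exact: measurable_funTS.
- by move=> y _; rewrite mule_ge0 ?lee_fin ?gam_ge0.
- exact: measurable_funTS.
apply: ge0_le_integral => //.
- move=> y; rewrite /= in_itv/= andbT => xy.
  by rewrite lee_fin mulr_ge0 ?gam_ge0// subr_ge0 ltW.
- by apply/measurable_EFinP/measurable_funTS; exact: mlin.
- by apply: emeasurable_funD; exact: measurable_funTS.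
- move=> y _; rewrite patchE; case: ifPn => [_|].
    by rewrite -EFinM -EFinD lee_fin le_eqVlt; apply/orP; left; apply/eqP; ring.
  rewrite mem_setE in_itv/= andbT -leNgt => yz.
  by rewrite add0e -EFinM lee_fin ler_wpM2r ?gam_ge0// lerD2r.
Qed.

Lemma tail1_lt (x z : R) : 0 < x -> x < z -> tail1 c z < tail1 c x.
Proof.
move=> x0 xz; apply: lt_le_trans (tail1_ge x0 (ltW xz)).
by rewrite ltrDl mulr_gt0 ?subr_gt0// tail0_gt0// (lt_trans x0).
Qed.

Lemma tail1_ge0 (x : R) : 0 < x -> 0 <= tail1 c x.
Proof. by move=> x0; rewrite -lee_fin tail1E//; case/andP: (lin_tail_le x0). Qed.

Lemma tail1_gt0 (x : R) : 0 < x -> 0 < tail1 c x.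
Proof.
move=> x0; apply: (@le_lt_trans _ _ (tail1 c (x + 1))); last by rewrite tail1_lt// ltrDl.
by rewrite tail1_ge0// addr_gt0.
Qed.

Lemma tail1_inj (x z : R) : 0 < x -> 0 < z -> tail1 c x = tail1 c z -> x = z.
Proof.
move=> x0 z0 xz; case: (ltgtP x z) => // h.
  by have := tail1_lt x0 h; rewrite xz ltxx.
by have := tail1_lt z0 h; rewrite xz ltxx.
Qed.

(* On ]0, 1] halving x adds at least a fixed amount, because u * bose u is nonincreasing;
   this avoids the logarithmic asymptotics of tail1 at 0. *)
Lemma tail1_double (x : R) : 0 < x -> x <= 1 ->
  tail1 c (2 * x) + 2 / (9 * c) * (9 * c / 2 * bose (9 * c / 2)) <= tail1 c x.
Proof.
move=> x0 x1; have xx : x <= 2 * x by lra.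
apply: le_trans (tail1_ge x0 xx); rewrite lerD2l.
have -> : 2 * x - x = x by ring.
have x20 : 0 < 2 * x by lra.
apply: (@le_trans _ _ (x * (x * gam c (2 * x + x)))); last first.
  by rewrite ler_pM2l// tail0_ge// ltW.
have u0 : 0 < c * 2^-1 * (2 * x + x) ^+ 2 by apply: half_sq_gt0 => //; lra.
rewrite gamE; last by lra.
have -> : x * (x * bose (c * 2^-1 * (2 * x + x) ^+ 2)) =
   2 / (9 * c) * (c * 2^-1 * (2 * x + x) ^+ 2 * bose (c * 2^-1 * (2 * x + x) ^+ 2)).
  by move: (bose _) => b; field; rewrite gt_eqF.
rewrite ler_wpM2l//; first by rewrite divr_ge0// mulr_ge0// ltW.
apply: mul_bose_le => //.
have -> : c * 2^-1 * (2 * x + x) ^+ 2 = 9 * c / 2 * x ^+ 2 by field.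
rewrite ler_piMr//; first by rewrite divr_ge0// mulr_ge0// ltW.
by rewrite expr2 mulr_ile1// ltW.
Qed.

Lemma tail1_unbounded (M : R) : exists2 x, 0 < x & M <= tail1 c x.
Proof.
set d := 2 / (9 * c) * (9 * c / 2 * bose (9 * c / 2)).
have d0 : 0 < d.
  have c9 : 0 < 9 * c / 2 by rewrite divr_gt0// mulr_gt0.
  apply: mulr_gt0; first by rewrite divr_gt0// mulr_gt0.
  by apply: mulr_gt0 => //; exact: bose_gt0.
have H n : n%:R * d <= tail1 c (2^-1 ^+ n).
  elim: n => [|n IH]; first by rewrite mul0r expr0 tail1_ge0.
  have p0 : 0 < 2^-1 ^+ n.+1 :> R by rewrite exprn_gt0.
  have p1 : 2^-1 ^+ n.+1 <= 1 :> R by rewrite exprn_ile1//; lra.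
  have := tail1_double p0 p1; rewrite -/d.
  have -> : 2 * 2^-1 ^+ n.+1 = 2^-1 ^+ n :> R by rewrite exprS mulrA mulfV// mul1r.
  by apply: le_trans; rewrite -natr1 mulrDl mul1r lerD2r.
exists (2^-1 ^+ (Num.truncn (M / d)).+1); first by rewrite exprn_gt0.
apply: le_trans (H _); rewrite -ler_pdivrMr// ltW//.
exact: truncnS_gt.
Qed.

Lemma tail1_continuous (x : R) : 0 < x -> {for x, continuous (tail1 c)}.
Proof.
move=> x0; have h0 : 0 < x / 2 by rewrite divr_gt0.
have T0 : 0 < tail0 c (x / 2) by exact: tail0_gt0.
have lip y z : x / 2 < y -> y <= z -> `|tail1 c y - tail1 c z| <= (z - y) * tail0 c (x / 2).
  move=> y0 yz; have yp := lt_trans h0 y0.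
  have le0 : tail0 c y <= tail0 c (x / 2).
    rewrite -lee_fin !tail0E//; apply: ge0_subset_integral => //.
    - by apply/measurable_EFinP/measurable_funTS; exact: mgam.
    - by move=> t _; rewrite lee_fin gam_ge0.
    - by apply: subset_itvr; rewrite bnd_simp ltW.
  have dec : tail1 c z <= tail1 c y.
    by move: yz; rewrite le_eqVlt => /predU1P[->//|yz]; rewrite ltW// tail1_lt.
  rewrite ger0_norm ?subr_ge0// lerBlDl (le_trans (tail1_lip yp yz))// lerD2l.
  by rewrite ler_wpM2l// subr_ge0.
apply/cvgrPdist_le => e e0; near=> y.
have xy2 : x / 2 < y.
  have : `|x - y| < x / 2 by near: y; apply: (@cvgr_dist_lt _ _ _ (nbhs x) _ id).
  by rewrite ltr_norml => /andP[_]; lra.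
have xy : `|x - y| <= e / tail0 c (x / 2).
  near: y; apply: (@cvgr_dist_le _ _ _ (nbhs x) _ id) => //; exact: divr_gt0.
have x2x : x / 2 < x by lra.
rewrite -[leRHS](mulfVK (lt0r_neq0 T0)).
apply: le_trans (_ : `|x - y| * tail0 c (x / 2) <= _); last by rewrite ler_wpM2r// ltW.
have [h|h] := leP x y.
  by rewrite (distrC x y) (ger0_norm (_ : 0 <= y - x)) ?subr_ge0// lip.
by rewrite distrC (ger0_norm (_ : 0 <= x - y)) ?subr_ge0 ?lip// ltW.
Unshelve. all: by end_near. Qed.

Lemma tail1_surj (t : R) : 0 < t -> exists2 x, 0 < x & tail1 c x = t.
Proof.
move=> t0; have [a a0 ta] := tail1_unbounded t.
(* At [b] the decay bound gives tail1 c b <= 2 / b <= t, while [a] comes from unboundedness near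
   0. *)
pose b := Num.max a (2 / t).
have ab : a <= b by rewrite le_max lexx.
have b0 := lt_le_trans a0 ab.
have tb : tail1 c b <= t.
  apply: le_trans (tail1_le b0) _.
  by rewrite ler_pdivrMr// mulrC -ler_pdivrMr// le_max lexx orbT.
have [||x] := @IVT R (tail1 c) a b t ab.
- apply: continuous_in_subspaceT => x; rewrite inE/= in_itv/= => /andP[ax _].
  exact: tail1_continuous (lt_le_trans a0 ax).
- by rewrite ge_min tb orbT le_max ta.
by rewrite in_itv/= => /andP[ax _] <-; exists x => //; exact: lt_le_trans ax.
Qed.
End Tails.

(** * The limit shape *)

(** The inverse of [tail1 c], by choice; for positive [c] with the normalization the default 1
    occurs only for t <= 0, outside the domain. *)
Definition shape (R : realType) (c t : R) : R :=
  xget 1 [set x : R | 0 < x /\ tail1 c x = t].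

Section Shape.
Context (R : realType) (c : R) (c0 : 0 < c).
Local Notation mu := (@lebesgue_measure R).
Context (norm1 : (\int[mu]_(y in `]0%R, +oo[) (y ^+ 2 / 2 * gam c y)%:E = 1)%E).

Lemma shapeP (t : R) : 0 < t -> 0 < shape c t /\ tail1 c (shape c t) = t.
Proof.
move=> /(tail1_surj c0 norm1)[x x0 xt]; rewrite /shape.
by case: xgetP => [y _ //|/(_ x)[]].
Qed.

Lemma shape_gt0 (t : R) : 0 < t -> 0 < shape c t.
Proof. by case/shapeP. Qed.

Lemma tail1_shape (t : R) : 0 < t -> tail1 c (shape c t) = t.
Proof. by case/shapeP. Qed.

Lemma shape_tail1 (x : R) : 0 < x -> shape c (tail1 c x) = x.
Proof.
move=> x0; have [s0 st] := shapeP (tail1_gt0 c0 norm1 x0).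
exact: tail1_inj st.
Qed.

Lemma lt_shape (t x : R) : 0 < t -> 0 < x -> (x < shape c t) = (t < tail1 c x).
Proof.
move=> t0 x0; have [s0 st] := shapeP t0; apply/idP/idP => [xs|].
  by rewrite -[ltLHS]st tail1_lt.
rewrite -[X in X < _]st; apply: contraTT; rewrite -!leNgt le_eqVlt => /predU1P[<-//|sx].
by rewrite ltW// tail1_lt.
Qed.

Lemma shape_continuous (t : R) : 0 < t -> {for t, continuous (shape c)}.
Proof.
move=> t0; have [s0 st] := shapeP t0.
apply/cvgrPdist_le => e e0.
pose d := Num.min e (shape c t / 2).
have d0 : 0 < d by rewrite lt_min e0 divr_gt0.
have de : d <= e by rewrite ge_min lexx.
have ds : d < shape c t.
  by rewrite gt_min ltr_pdivrMr// ltr_pMr// ltr1n orbT.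
have a0 : 0 < shape c t - d by rewrite subr_gt0.
have b0 : 0 < shape c t + d by rewrite addr_gt0.
have ta : t < tail1 c (shape c t - d) by rewrite -lt_shape// gtrBl.
have tb : tail1 c (shape c t + d) < t by rewrite -[ltRHS]st tail1_lt// ltrDl.
near=> u.
have ua : u < tail1 c (shape c t - d) by near: u; apply: (cvgr_lt (f := id) t).
have ub : tail1 c (shape c t + d) < u by near: u; apply: (cvgr_gt (f := id) t).
have u0 : 0 < u by apply: le_lt_trans ub; rewrite ltW// tail1_gt0.
have lo : shape c t - d < shape c u by rewrite lt_shape.
have hi : shape c u <= shape c t + d by rewrite leNgt lt_shape// -leNgt ltW.
by rewrite ler_distl; apply/andP; split; move: lo hi de; clear; lra.
Unshelve. all: by end_near. Qed.

(** By Tonelli on x < y, the integral of y - x over 0 < x < y being y^2 / 2, this is the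
    normalization of [gam]. *)
Lemma integral_tail1 :
  (\int[mu]_(x in `]0%R, +oo[) (tail1 c x)%:E = 1)%E.
Proof.
pose f (z : R * R) := ((z.2 - z.1) * gam c z.2)%:E.
have mf : measurable_fun setT f.
  apply/measurable_EFinP; apply: measurable_funM.
    by apply: measurable_funB; [exact: measurable_snd|exact: measurable_fst].
  by apply: measurableT_comp; [exact: mgam|exact: measurable_snd].
transitivity (\int[mu]_(x in `]0%R, +oo[) \int[mu]_(y in `]x, +oo[) f (x, y))%E.
  by apply: eq_integral => x; rewrite inE/= in_itv/= andbT => x0; rewrite tail1E.
rewrite tonelli_triangle//; last first.
  move=> x y x0 xy; rewrite /f/= lee_fin; apply: mulr_ge0; last exact: gam_ge0.
  by rewrite subr_ge0 ltW.
rewrite -norm1; apply: eq_integral => y; rewrite inE/= in_itv/= andbT => y0.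
rewrite [LHS](_ : _ = \int[mu]_(x in `]0%R, y[) ((y - x) * gam c y)%:E)%E //.
have mg : measurable_fun setT (fun x : R => (y - x) * gam c y).
  by apply: measurable_funM => //; exact: measurable_funB.
rewrite -(integral_itv_bndoo true false); last first.
  by apply/measurable_EFinP/measurable_funTS.
have dF (x : R) : is_derive x 1 (fun x : R => (y * x - x ^+ 2 / 2) * gam c y) ((y - x) * gam c y).
  by apply: is_derive_eq; rewrite /GRing.scale/=; field.
have cF : continuous (fun x : R => (y * x - x ^+ 2 / 2) * gam c y).
  move=> x; apply: differentiable_continuous; apply/derivable1_diffP.
  by case: (dF x).
rewrite (continuous_FTC2 (F := fun x : R => (y * x - x ^+ 2 / 2) * gam c y))//.
- by rewrite -EFinB; congr EFin; field.
- apply: continuous_subspaceT => x; apply: cvgM; last exact: cvg_cst.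
  by apply: cvgB; [exact: cvg_cst|exact: cvg_id].
- split.
  + by move=> x _; case: (dF x).
  + by apply: cvg_at_right_filter; exact: cF.
  + by apply: cvg_at_left_filter; exact: cF.
- by move=> x _; rewrite derive1E; case: (dF x).
Qed.

(** The region under the graph of a decreasing bijection is, with the axes exchanged, the region
    under its inverse, so [shape c] has the same area as [tail1 c]. *)
Lemma integral_shape : (\int[mu]_(t in `]0%R, +oo[) (shape c t)%:E = 1)%E.
Proof.
rewrite -integral_tail1.
pose T0 : R -> R := (tail1 c) \_ `]0, +oo[.
have mT0 : measurable_fun setT T0.
  apply/(measurable_restrictT _ (measurable_itv _)).
  apply: nonincreasing_pos_measurable => x z x0; rewrite le_eqVlt => /predU1P[->//|xz].
  by rewrite ltW// tail1_lt.
have T0E x : 0 < x -> T0 x = tail1 c x.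
  by move=> x0; rewrite /T0 patchE mem_setE in_itv/= x0.
have T0n x : ~~ (0 < x) -> T0 x = 0.
  by move=> x0; rewrite /T0 patchE mem_setE in_itv/= andbT (negbTE x0).
pose A : set (R * R) := [set z | 0 < z.1 /\ z.1 < T0 z.2].
have mA : measurable A.
  have -> : A = ((fst : R * R -> R) @^-1` `]0, +oo[) `&`
                ((fun z : R * R => T0 z.2 - z.1) @^-1` `]0, +oo[).
    by apply/seteqP; split => [[x y]|[x y]] /=; rewrite !in_itv/= !andbT subr_gt0.
  apply: measurableI; rewrite -[X in measurable X]setTI.
    exact: measurable_fst.
  have mh : measurable_fun setT (fun z : R * R => T0 z.2 - z.1).
    apply: measurable_funB; last exact: measurable_fst.
    by apply: measurableT_comp => //; exact: measurable_snd.
  exact: mh.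
have AE t x : A (t, x) <-> [/\ 0 < t, 0 < x & t < tail1 c x].
  rewrite /A/=; split=> [[t0]|[t0 x0 tx]]; last by rewrite T0E.
  have [x0|x0] := boolP (0 < x); first by rewrite T0E.
  by rewrite T0n// => /(lt_trans t0); rewrite ltxx.
have D1 t x : A (t, x) <-> `]0, +oo[%classic t /\ `]0, shape c t[%classic x.
  rewrite AE /= !in_itv/= !andbT; split=> [[t0 x0 tx]|[t0 /andP[x0]]].
    by rewrite x0 t0 lt_shape.
  by rewrite lt_shape.
have D2 t x : A (t, x) <-> `]0, +oo[%classic x /\ `]0, tail1 c x[%classic t.
  rewrite AE /= !in_itv/= !andbT; split=> [[t0 x0 tx]|[x0 /andP[]]]//.
  by rewrite x0 t0.
have := @tonelli_section R A (fun=> 1%E) _ _ _ _ mA (measurable_cst _) (fun _ _ => lee01) D1 D2.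
move=> H; transitivity (\int[mu]_(t in `]0%R, +oo[) \int[mu]_(x in `]0%R, shape c t[) 1%:E)%E.
  apply: eq_integral => t; rewrite inE/= in_itv/= andbT => t0.
  by rewrite (integral_itv_cst 1 false true (ltW (shape_gt0 t0))) mul1r subr0.
apply: eq_trans H _; apply: eq_integral => x; rewrite inE/= in_itv/= andbT => x0.
rewrite (integral_itv_cst 1 false true (ltW (tail1_gt0 c0 norm1 x0))).
by rewrite mul1r subr0.
Qed.
End Shape.

(** * Riemann sums *)

(** Cost of one staircase with j + 1 rows; it is close to c y^2 / 2 at y = j h, the argument of
    [bose] in [gam]. *)
Definition energy (R : realType) (c h : R) (j : nat) : R := c * h ^+ 2 * (tri j)%:R.

Lemma triE (R : realType) (j : nat) : (tri j)%:R = (j.+1%:R * j.+2%:R) / 2 :> R.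
Proof.
have : (tri j * 2 = j.+1 * j.+2)%N by rewrite /tri muln2 bin2 /= -[RHS]mulnC;
  have := odd_double_half (j.+2 * j.+1); rewrite oddM /= andNb add0n.
by move=> /(congr1 (fun n => n%:R : R)); rewrite !natrM => <-; rewrite mulfK.
Qed.

Section Cells.
Context (R : realType) (h : R) (h0 : 0 < h) (F : R -> R).
Local Notation mu := (@lebesgue_measure R).
Context (mF : measurable_fun setT F).
Local Notation cell j := (`](j%:R * h)%R, (j.+1%:R * h)%R]%classic : set R).

Lemma integral_cells (m n : nat) : (m <= n)%N -> (forall y, m%:R * h < y -> 0 <= F y) ->
  (\int[mu]_(y in `](m%:R * h)%R, (n%:R * h)%R]) (F y)%:E =
   \sum_(m <= j < n) \int[mu]_(y in cell j) (F y)%:E)%E.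
Proof.
move=> mn F0; elim: n mn => [|n IH].
  by rewrite leqn0 => /eqP ->; rewrite big_nil set_itvoc0 integral_set0.
rewrite leq_eqVlt => /predU1P[->|].
  by rewrite big_geq// set_itvoc0 integral_set0.
rewrite ltnS => mn; rewrite big_nat_recr//= -IH//.
have mnh : m%:R * h <= n%:R * h by rewrite ler_wpM2r ?ler_nat// ltW.
have nSh : n%:R * h <= n.+1%:R * h by rewrite ler_wpM2r ?ler_nat// ltW.
have E : (`](m%:R * h)%R, (n.+1%:R * h)%R] = `](m%:R * h)%R, (n%:R * h)%R] `|` cell n)%classic.
  by rewrite -itv_bndbnd_setU// bnd_simp.
rewrite E ge0_integral_setU//.
- by apply/measurable_EFinP/measurable_funTS.
- by move=> y; rewrite -E /= in_itv/= => /andP[my _]; rewrite lee_fin F0.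
- rewrite disj_set2E; apply/eqP/seteqP; split=> // y /=.
  by rewrite !in_itv/= => -[/andP[_ yn] /andP[]]; rewrite ltNge yn.
Qed.

Lemma integral_cell_cst (j : nat) (b : R) : (\int[mu]_(_ in cell j) b%:E = (h * b)%:E)%E.
Proof.
rewrite (integral_itv_cst b false false); first by rewrite -natr1; congr EFin; ring.
by rewrite ler_wpM2r ?ler_nat// ltW.
Qed.

Lemma cells_lower (m n : nat) (b : nat -> R) : (m <= n)%N ->
  (forall y, m%:R * h < y -> 0 <= F y) -> (forall j, 0 <= b j) ->
  (forall j y, (m <= j < n)%N -> j%:R * h < y -> y <= j.+1%:R * h -> b j <= F y) ->
  ((\sum_(m <= j < n) h * b j)%:E <= \int[mu]_(y in `](m%:R * h)%R, (n%:R * h)%R]) (F y)%:E)%E.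
Proof.
move=> mn F0 b0 bF; rewrite integral_cells// -sumEFin.
rewrite !big_nat; apply: lee_sum => j mj.
rewrite -(integral_cell_cst j); apply: ge0_le_integral => //.
- by move=> y _; rewrite lee_fin.
- by apply/measurable_EFinP/measurable_funTS.
- by move=> y; rewrite /= in_itv/= => /andP[y1 y2]; rewrite lee_fin bF.
Qed.

Lemma cells_upper (m n : nat) (b : nat -> R) : (m <= n)%N ->
  (forall y, m%:R * h < y -> 0 <= F y) ->
  (forall j y, (m <= j < n)%N -> j%:R * h < y -> y <= j.+1%:R * h -> F y <= b j) ->
  (\int[mu]_(y in `](m%:R * h)%R, (n%:R * h)%R]) (F y)%:E <= (\sum_(m <= j < n) h * b j)%:E)%E.
Proof.
move=> mn F0 bF; rewrite integral_cells// -sumEFin.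
rewrite !big_nat; apply: lee_sum => j /andP[mj jn].
rewrite -(integral_cell_cst j); apply: ge0_le_integral => //.
- move=> y; rewrite /= in_itv/= => /andP[y1 _]; rewrite lee_fin F0//.
  by apply: le_lt_trans y1; rewrite ler_wpM2r ?ler_nat// ltW.
- by apply/measurable_EFinP/measurable_funTS.
- by move=> y; rewrite /= in_itv/= => /andP[y1 y2]; rewrite lee_fin bF// mj.
Qed.
End Cells.

Section RiemannSums.
Context (R : realType) (c : R) (c0 : 0 < c).
Local Notation mu := (@lebesgue_measure R).
Context (norm1 : (\int[mu]_(y in `]0%R, +oo[) (y ^+ 2 / 2 * gam c y)%:E = 1)%E).

Lemma energy_gt0 (h : R) (j : nat) : 0 < h -> 0 < energy c h j.
Proof. by move=> h0; rewrite /energy triE !mulr_gt0 ?exprn_gt0. Qed.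

(** The product (j + 1) (j + 2) lies between two consecutive squares. This sandwich is the source of
    the index shifts by one and two in the Riemann sums below. *)
Lemma energy_bounds (h : R) (j : nat) : 0 < h ->
  c * 2^-1 * (j.+1%:R * h) ^+ 2 <= energy c h j <= c * 2^-1 * (j.+2%:R * h) ^+ 2.
Proof.
move=> h0; have h2 : 0 <= c * 2^-1 * h ^+ 2 by rewrite !mulr_ge0 ?exprn_ge0 ?ltW.
rewrite /energy triE.
have -> : c * h ^+ 2 * (j.+1%:R * j.+2%:R / 2) = c * 2^-1 * h ^+ 2 * (j.+1%:R * j.+2%:R) by field.
have E m : c * 2^-1 * (m%:R * h) ^+ 2 = c * 2^-1 * h ^+ 2 * (m%:R * m%:R) by ring.
by rewrite !E; apply/andP; split; apply: ler_wpM2l => //; rewrite -!natrM ler_nat leq_mul.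
Qed.

Lemma bose_energy_bounds (h : R) (j : nat) : 0 < h ->
  gam c (j.+2%:R * h) <= bose (energy c h j) <= gam c (j.+1%:R * h).
Proof.
move=> h0; have /andP[lo hi] := energy_bounds j h0.
have p m : 0 < m.+1%:R * h by rewrite mulr_gt0.
by rewrite !gamE// !bose_le ?energy_gt0// half_sq_gt0.
Qed.

(** A lower Riemann sum: on the cell from j h to (j + 1) h, y - k h is at least (j - k) h and [gam]
    is at least [bose] of the energy of j. Bounding row k + 1 by the integral from k h makes the
    cells match. *)
Lemma rows_sum_le (h : R) (k J : nat) : 0 < h -> (0 < k)%N -> (k <= J)%N ->
  h ^+ 2 * \sum_(j < J) (j.+1 - k.+1)%:R * bose (energy c h j) <= tail1 c (k%:R * h).
Proof.
move=> h0 k0 kJ; have kh0 : 0 < k%:R * h by rewrite mulr_gt0 ?ltr0n.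
rewrite -lee_fin tail1E//.
rewrite -(big_mkord xpredT (fun j => (j.+1 - k.+1)%:R * bose (energy c h j))).
rewrite (big_cat_nat (n := k))//= big_nat_cond big1 ?add0r; last first.
  move=> j; rewrite andbT => /andP[_ jk].
  by rewrite (eqP (_ : j.+1 - k.+1 == 0)%N) ?mul0r// subn_eq0; lia.
have -> : h ^+ 2 * (\sum_(k <= j < J) (j.+1 - k.+1)%:R * bose (energy c h j)) =
    \sum_(k <= j < J) h * ((j - k)%:R * h * bose (energy c h j)).
  rewrite mulr_sumr; apply: eq_bigr => j _; rewrite subSS.
  by move: (bose _) (_%:R) => x y; ring.
apply: le_trans (cells_lower h0 (mlin c0 (k%:R * h)) kJ _ _ _) _.
- by move=> y ky; rewrite mulr_ge0 ?gam_ge0// subr_ge0 ltW.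
- move=> j; apply: mulr_ge0; first by rewrite mulr_ge0// ltW.
  by rewrite ltW// bose_gt0// energy_gt0.
- move=> j y /andP[kj jJ] jy yj; have /andP[_ hi] := bose_energy_bounds j h0.
  have y0 : 0 < y by apply: le_lt_trans jy; rewrite mulr_ge0// ltW.
  have kjh : k%:R * h <= j%:R * h by rewrite ler_wpM2r ?ler_nat// ltW.
  apply: ler_pM => //.
  + by rewrite mulr_ge0// ltW.
  + by rewrite ltW// bose_gt0// energy_gt0.
  + by rewrite natrB// mulrBl lerD2r ltW.
  + by rewrite (le_trans hi)// gam_le.
apply: ge0_subset_integral => //.
- by apply/measurable_EFinP/measurable_funTS; exact: mlin.
- move=> y; rewrite /= in_itv/= andbT => ky.
  by rewrite lee_fin mulr_ge0 ?gam_ge0// subr_ge0 ltW.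
- by apply: subset_itvl.
Qed.

Lemma lin_tail_bound (a Y y : R) : 0 <= a -> a <= Y -> 0 < Y -> Y < y ->
  0 <= (y - a) * gam c y <= 2 / Y * (y ^+ 2 / 2 * gam c y).
Proof.
move=> a0 aY Y0 Yy; have y0 := lt_trans Y0 Yy.
apply/andP; split; first by rewrite mulr_ge0 ?gam_ge0// subr_ge0 (le_trans aY)// ltW.
rewrite mulrA ler_wpM2r ?gam_ge0//.
have -> : 2 / Y * (y ^+ 2 / 2) = y ^+ 2 / Y by field; rewrite gt_eqF.
rewrite (@le_trans _ _ y)//; first by rewrite gerBl.
by rewrite ler_pdivlMr// expr2 ler_pM2l// ltW.
Qed.

(** An upper Riemann sum: column j is compared with cell j + 2, on which [gam] is at most [bose] of
    the energy of j. The subtracted term bounds the part of the integral beyond (J + 2) h. *)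
Lemma rows_sum_ge (h : R) (i J : nat) : 0 < h -> (i <= J)%N ->
  tail1 c (i.+2%:R * h) - 2 / (J.+2%:R * h) <=
  h ^+ 2 * \sum_(j < J) (j.+1 - i)%:R * bose (energy c h j).
Proof.
move=> h0 iJ; have p m : 0 < m.+1%:R * h by rewrite mulr_gt0.
have iJh : i.+2%:R * h <= J.+2%:R * h by rewrite ler_wpM2r ?ler_nat// ltW.
rewrite lerBlDr -lee_fin EFinD tail1E//.
have lin0 y : i.+2%:R * h < y -> 0 <= (y - i.+2%:R * h) * gam c y.
  by move=> iy; rewrite mulr_ge0 ?gam_ge0// subr_ge0 ltW.
have E : (`](i.+2%:R * h)%R, +oo[ =
    `](i.+2%:R * h)%R, (J.+2%:R * h)%R] `|` `](J.+2%:R * h)%R, +oo[ :> set R)%classic.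
  by rewrite -itv_bndbnd_setU// bnd_simp.
rewrite E ge0_integral_setU//; last 3 first.
- by apply/measurable_EFinP/measurable_funTS; exact: mlin.
- by move=> y; rewrite -E /= in_itv/= andbT => iy; rewrite lee_fin lin0.
- rewrite disj_set2E; apply/eqP/seteqP; split=> // y /=.
  by rewrite !in_itv/= andbT => -[/andP[_ yn]]; rewrite ltNge yn.
apply: leeD; last first.
  have k0 : 0 <= 2 / (J.+2%:R * h) by rewrite divr_ge0// ltW.
  have bd y : J.+2%:R * h < y -> 0 <= (y - i.+2%:R * h) * gam c y <=
      2 / (J.+2%:R * h) * (y ^+ 2 / 2 * gam c y).
    by apply: lin_tail_bound => //; rewrite ltW.
  by have /andP[] := integral_tail_le c0 norm1 (p J.+1) k0 (mlin c0 (i.+2%:R * h)) bd.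
rewrite -(big_mkord xpredT (fun j => (j.+1 - i)%:R * bose (energy c h j))).
apply: (@le_trans _ _ (\sum_(i.+2 <= j < J.+2)
  h * ((j.+1 - i.+2)%:R * h * bose (energy c h (j - 2))))%:E).
  apply: (cells_upper h0 (mlin c0 (i.+2%:R * h))) => //.
  move=> [|[|j]] y //; rewrite !ltnS => /andP[ij jJ] jy yj; rewrite !subSS subn0.
  have /andP[lo _] := bose_energy_bounds j h0.
  apply: ler_pM => //.
  + by rewrite subr_ge0 ltW// (le_lt_trans _ jy)// ler_wpM2r ?ler_nat// ltW.
  + exact: gam_ge0.
  + rewrite -subSS -subSS natrB; last by rewrite !ltnS (leq_trans ij).
    by rewrite mulrBl lerD2r.
  + by rewrite (le_trans _ lo)// gam_le// ltW.
rewrite lee_fin -[i.+2]addn2 big_addn subn2/=.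
rewrite [leRHS](_ : _ = h ^+ 2 * \sum_(i <= j < J) (j.+1 - i)%:R * bose (energy c h j)).
  rewrite mulr_sumr le_eqVlt; apply/orP; left; apply/eqP; apply: eq_bigr => j _.
  have -> : ((j + 2).+1 - (i + 2) = j.+1 - i)%N by lia.
  rewrite addnK.
  by move: (bose _) (_%:R) => x y; ring.
congr (_ * _); rewrite (big_cat_nat (n := i))//= big_nat_cond big1 ?add0r//.
move=> j; rewrite andbT => /andP[_ ji].
by rewrite (eqP (_ : j.+1 - i == 0)%N) ?mul0r// subn_eq0.
Qed.

(** The left side is c h^2 times the Boltzmann mean size, so this says that the mean size is at most
    h^(-3), for every [J]. As u bose u is nonincreasing, the sum is a lower Riemann sum of the
    normalization integral. *)
Lemma energy_sum_le (h : R) (J : nat) : 0 < h ->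
  \sum_(j < J) energy c h j * bose (energy c h j) <= c / h.
Proof.
move=> h0; rewrite ler_pdivlMr// mulrC -lee_fin.
rewrite -(big_mkord xpredT (fun j => energy c h j * bose (energy c h j))) mulr_sumr.
have sq0 y : 0 <= c * (y ^+ 2 / 2 * gam c y).
  by rewrite mulr_ge0 ?(ltW c0)// mulr_ge0 ?gam_ge0// divr_ge0 ?sqr_ge0.
have mk : measurable_fun setT (fun y : R => c * (y ^+ 2 / 2 * gam c y)).
  by apply: measurable_funM => //; exact: msqr_gam.
have e0 j := energy_gt0 j h0.
apply: le_trans (cells_lower h0 mk (leq0n J) _ _ _) _.
- by [].
- by move=> j; exact: mul_bose_ge0.
- move=> j y _ jy yj; have y0 : 0 < y by apply: le_lt_trans jy; rewrite mulr_ge0// ltW.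
  have -> : c * (y ^+ 2 / 2 * gam c y) = c * 2^-1 * y ^+ 2 * bose (c * 2^-1 * y ^+ 2).
    by rewrite gamE//; move: (bose _) => b; field.
  apply: mul_bose_le; first exact: half_sq_gt0.
  have /andP[lo _] := energy_bounds j h0; apply: le_trans lo.
  rewrite ler_pM2l ?mulr_gt0// lerXn2r ?nnegrE//; first exact: ltW.
  by rewrite mulr_ge0// ltW.
apply: (@le_trans _ _ (\int[mu]_(y in `]0%R, +oo[) (c * (y ^+ 2 / 2 * gam c y))%:E)%E).
  apply: ge0_subset_integral => //.
  - exact/measurable_EFinP/measurable_funTS.
  - by move=> y _; rewrite lee_fin.
  - by rewrite mul0r; apply: subset_itvl.
under eq_integral do rewrite EFinM.
rewrite ge0_integralZl_EFin//; last 3 first.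
- by move=> y _; rewrite lee_fin mulr_ge0 ?gam_ge0// divr_ge0 ?sqr_ge0.
- by apply/measurable_EFinP/measurable_funTS; exact: msqr_gam.
- exact: ltW.
by rewrite norm1 mule1.
Qed.

(** Energies are quadratic in the mesh, so a quarter of the energy at mesh h is the energy at mesh h
    / 2. *)
Lemma energy_quarter_sum_le (h : R) (J : nat) : 0 < h ->
  \sum_(j < J) energy c h j / 4 * bose (energy c h j / 4) <= 2 * c / h.
Proof.
move=> h0; have h20 : 0 < h / 2 by rewrite divr_gt0.
have := energy_sum_le J h20.
have -> : c / (h / 2) = 2 * c / h by field; rewrite gt_eqF.
apply: le_trans; rewrite le_eqVlt; apply/orP; left; apply/eqP; apply: eq_bigr => j _.
by have -> : energy c h j / 4 = energy c (h / 2) j by rewrite /energy; field.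
Qed.

(** The mean size is also nearly h^(-3) from below once the columns reach [Y], a point below which
    the normalized density has mass at least 1 - eps. The loss 2 h comes from the first two cells,
    which the shifted upper sum leaves out. *)
Lemma energy_sum_ge (eps : R) : 0 < eps -> exists Y : R, forall (h : R) (J : nat), 0 < h ->
  Y <= J%:R * h -> (c * (1 - eps) - 2 * h) / h <=
  \sum_(j < J) energy c h j * bose (energy c h j).
Proof.
move=> eps0.
pose f y : R := y ^+ 2 / 2 * gam c y.
have f0 y : 0 <= f y by rewrite /f mulr_ge0 ?gam_ge0// divr_ge0 ?sqr_ge0.
have mf : measurable_fun setT f by exact: msqr_gam.
have := ge0_cvgn_integral (mu := mu) f0 mf.
have mfE (D : set R) : measurable_fun D (EFin \o f).
  by apply/measurable_EFinP; exact: measurable_funTS.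
rewrite -integral_itv_obnd_cbnd; last exact: mfE.
rewrite norm1 => /fine_cvgP[_ /cvgrPdist_lt/(_ _ eps0)[N _ HN]].
have {}HN : 1 - eps <= fine (\int[mu]_(y in `[0%R, N%:R]) (f y)%:E)%E.
  by have := HN N (leqnn N); rewrite /= ltr_norml => /andP[_]; lra.
exists N%:R => h J h0 NJ.
have I01 (D : set R) : measurable D -> D `<=` `[0, +oo[%classic ->
    (0 <= \int[mu]_(y in D) (f y)%:E <= 1%:E)%E.
  move=> mD D0; apply/andP; split; first by apply: integral_ge0 => y _; rewrite lee_fin.
  rewrite -norm1 [leRHS]integral_itv_obnd_cbnd; last exact: mfE.
  by apply: ge0_subset_integral => //; [exact: mfE|move=> y _; rewrite lee_fin].
have J2 : 2%:R * h <= J.+2%:R * h by rewrite ler_wpM2r ?ler_nat// ltW.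
have J0 : 0 <= 2%:R * h by rewrite mulr_ge0// ltW.
have big : ((1 - eps)%:E <= \int[mu]_(y in `[0%R, (J.+2%:R * h)%R]) (f y)%:E)%E.
  apply: (@le_trans _ _ (\int[mu]_(y in `[0%R, N%:R]) (f y)%:E)%E).
    rewrite -(fineK_le (I01 _ _ _)) ?lee_fin//; apply: subset_itvl => //.
  apply: ge0_subset_integral => //; [exact: mfE|by move=> y _; rewrite lee_fin|].
  apply: subset_itvl; rewrite bnd_simp (le_trans NJ)//.
  by rewrite ler_pM2r// ler_nat -addn2 leq_addr.
have E : (`[0%R, (J.+2%:R * h)%R] =
    `[0%R, (2%:R * h)%R] `|` `](2%:R * h)%R, (J.+2%:R * h)%R] :> set R)%classic.
  by rewrite -itv_bndbnd_setU// bnd_simp.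
rewrite E ge0_integral_setU// in big; last 3 first.
- exact: mfE.
- by move=> y _; rewrite lee_fin.
- rewrite disj_set2E; apply/eqP/seteqP; split=> // y /=.
  by rewrite !in_itv/= => -[/andP[_ yn] /andP[]]; rewrite ltNge yn.
(* The density is u bose u / c with u = c y^2 / 2, and u bose u <= 1, so the factor y^2 cancels the
   singularity of [gam] at 0. *)
have fc y : 0 <= y -> f y <= c^-1.
  rewrite le_eqVlt => /predU1P[<-|y0].
    by rewrite /f expr0n/= !mul0r invr_ge0 ltW.
  have -> : f y = c^-1 * (c * 2^-1 * y ^+ 2 * bose (c * 2^-1 * y ^+ 2)).
    by rewrite /f gamE//; move: (bose _) => b; field; rewrite gt_eqF.
  by rewrite ler_piMr ?invr_ge0 ?(ltW c0)// mul_bose_le1// half_sq_gt0.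
have small : (\int[mu]_(y in `[0%R, (2%:R * h)%R]) (f y)%:E <= (c^-1 * (2 * h))%:E)%E.
  rewrite -[X in (_ <= (_ * X)%:E)%E]subr0 -(integral_itv_cst _ true false J0).
  apply: ge0_le_integral => //; first by move=> y _; rewrite lee_fin.
    exact: mfE.
  by move=> y; rewrite /= in_itv/= => /andP[y0 _]; rewrite lee_fin fc.
have up : (\int[mu]_(y in `](2%:R * h)%R, (J.+2%:R * h)%R]) (f y)%:E <=
    (\sum_(2 <= j < J.+2) h * (c^-1 * (energy c h (j - 2) * bose (energy c h (j - 2)))))%:E)%E.
  apply: (cells_upper h0 mf) => //.
  move=> [|[|j]] y // _ jy yj; rewrite !subSS subn0.
  have y0 : 0 < y by apply: le_lt_trans jy; rewrite mulr_ge0// ltW.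
  have -> : f y = c^-1 * (c * 2^-1 * y ^+ 2 * bose (c * 2^-1 * y ^+ 2)).
    by rewrite /f gamE//; move: (bose _) => b; field; rewrite gt_eqF.
  rewrite ler_pM2l ?invr_gt0// mul_bose_le ?energy_gt0//.
  have /andP[_ hi] := energy_bounds j h0; apply: le_trans hi _.
  by rewrite ler_pM2l ?mulr_gt0// lerXn2r ?nnegrE ?mulr_ge0 ?(ltW h0)// ltW.
have := le_trans big (leeD small up).
have -> : \sum_(2 <= j < J.+2) h * (c^-1 * (energy c h (j - 2) * bose (energy c h (j - 2)))) =
    \sum_(0 <= j < J) h * (c^-1 * (energy c h j * bose (energy c h j))).
  rewrite -[X in \sum_(X <= _ < _) _]add0n big_addn subn2/=.
  by apply: eq_bigr => j _; rewrite addnK.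
rewrite -EFinD lee_fin.
rewrite -(big_mkord xpredT (fun j => energy c h j * bose (energy c h j))).
rewrite -!mulr_sumr; move: (\sum_(_ <= _ < _) _) => S H.
rewrite ler_pdivrMr//.
have := ler_wpM2l (ltW c0) H.
have -> : c * (c^-1 * (2 * h) + h * (c^-1 * S)) = 2 * h + S * h.
  by field; rewrite gt_eqF.
by clear; lra.
Qed.
End RiemannSums.

(** * Concentration and counting *)

Definition config_weight (J K : nat) (f : {ffun 'I_J -> 'I_K}) : nat :=
  weight (fun j => nat_of_ord (f j)).
Definition config_row (J K : nat) (f : {ffun 'I_J -> 'I_K}) : nat -> nat :=
  rows (fun j => nat_of_ord (f j)).

Lemma cvg_truncated_partition_fun (R : realType) (J : nat) (u : nat -> R) :
  (forall j, 0 < u j) ->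
  \prod_(j < J) \sum_(k < K) expR (- u j) ^+ k @[K --> \oo] --> partition_fun J u.
Proof.
move=> u0; rewrite /partition_fun; elim: J => [|J IH].
  under eq_fun do rewrite big_ord0.
  by rewrite big_ord0; exact: cvg_cst.
under eq_fun do rewrite big_ord_recr/=.
rewrite big_ord_recr/=; apply: cvgM => //.
have q1 : `|expR (- u J)| < 1 by rewrite gtr0_norm ?expR_gt0// expR_lt1 oppr_lt0.
have := @cvg_geometric_series R 1 _ q1; rewrite mul1r; apply: cvg_trans.
apply: near_eq_cvg; apply: nearW => K.
by rewrite /series/= big_mkord; apply: eq_bigr => k _; rewrite mul1r.
Qed.

(** The derivative of - log (1 - exp (- u)) is - bose u and [bose] is decreasing, so each logarithm
    drops by at most (v - u) bose u. *)
Lemma partition_fun_ratio (R : realType) (J : nat) (u v : nat -> R) :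
  (forall j, 0 < u j) -> (forall j, u j <= v j) ->
  partition_fun J u <= partition_fun J v * expR (\sum_(j < J) (v j - u j) * bose (u j)).
Proof.
move=> u0 uv; rewrite /partition_fun expR_sum -big_split/=; apply: ler_prod => j _.
have v0 := lt_le_trans (u0 j) (uv j).
have p w : 0 < w -> 0 < 1 - expR (- w) :> R by move=> w0; rewrite subr_gt0 expR_lt1 oppr_lt0.
rewrite invr_ge0 (ltW (p _ (u0 j)))/= mulrC ler_pdivlMr ?p// mulrC ler_pdivrMr ?p//.
apply: (@le_trans _ _ ((1 + (v j - u j) * bose (u j)) * (1 - expR (- u j)))); last first.
  by rewrite ler_wpM2r ?expR_ge1Dx// ltW// p.
have -> : (1 + (v j - u j) * bose (u j)) * (1 - expR (- u j)) =
    1 - expR (- u j) + (v j - u j) * expR (- u j).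
  by rewrite /bose; field; rewrite gt_eqF ?p.
have -> : - v j = - u j + (u j - v j) by ring.
rewrite expRD; have := expR_ge1Dx (u j - v j); have := expR_gt0 (- u j).
by move: (expR (- u j)) (expR (u j - v j)) => x y x0 yge; nra.
Qed.

Section Concentration.
Context (R : realType) (c : R) (c0 : 0 < c).
Local Notation mu := (@lebesgue_measure R).
Context (norm1 : (\int[mu]_(y in `]0%R, +oo[) (y ^+ 2 / 2 * gam c y)%:E = 1)%E).

Lemma energy_sum (h : R) (J K : nat) (f : {ffun 'I_J -> 'I_K}) :
  \sum_(j < J) energy c h j * (f j)%:R = c * h ^+ 2 * (config_weight f)%:R.
Proof.
rewrite /config_weight /weight natr_sum mulr_sumr.
by apply: eq_bigr => j _; rewrite natrM mulrA.
Qed.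

Lemma boltz_energy (h : R) (J K : nat) (f : {ffun 'I_J -> 'I_K}) :
  boltz (energy c h) f = expR (- (c * h ^+ 2 * (config_weight f)%:R)).
Proof. by rewrite /boltz energy_sum. Qed.

Lemma chernoff_energy (h : R) (J K : nat) (v : nat -> R) (rho B : R)
    (P : pred {ffun 'I_J -> 'I_K}) :
  0 < h -> 0 <= rho -> rho <= 4^-1 ->
  (forall j, `|v j| <= rho * energy c h j) ->
  (forall e, P e -> B <= \sum_(j < J) v j * (e j)%:R) ->
  \sum_(e | P e) boltz (energy c h) e <= partition_fun J (energy c h) *
    expR (- B + \sum_(j < J) v j * bose (energy c h j) + 20 * c * rho ^+ 2 / h).
Proof.
move=> h0 r0 r4 vru PB; have e0 j := energy_gt0 c0 j h0.
apply: le_trans (chernoff e0 r0 r4 vru PB) _.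
rewrite ler_pM2l ?partition_fun_gt0// ler_expR lerD2l.
have := energy_quarter_sum_le c0 norm1 J h0.
move/(ler_wpM2l (_ : 0 <= 10 * rho ^+ 2)) => /(_ _)/le_trans; apply.
  by rewrite mulr_ge0 ?sqr_ge0.
by rewrite le_eqVlt; apply/orP; left; apply/eqP; field; rewrite gt_eqF.
Qed.

(** Chernoff with a tilt proportional to the coefficients (j + 1 - i) of row [i]; the sign [s]
    selects the tail. Columns with j >= i have (j + 2) h >= b, so their energies dominate the tilt:
    this is where the row index must stay of order 1 / h. The gain is linear in [rho] and the loss
    quadratic. *)
Lemma rows_deviation (s a eta b rho h : R) (i J K N : nat) (P : pred {ffun 'I_J -> 'I_K}) :
  `|s| = 1 -> 0 < h -> h ^+ 3 * N%:R = 1 -> 0 <= rho -> rho <= 4^-1 ->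
  0 <= b -> b <= i.+1%:R * h ->
  (forall e, P e -> config_weight e = N /\ s * a <= s * (config_row e i)%:R) ->
  eta <= s * (h ^+ 2 * a - h ^+ 2 * \sum_(j < J) (j.+1 - i)%:R * bose (energy c h j)) ->
  #|P|%:R <= partition_fun J (energy c h) * expR (c / h) *
             expR (- (rho * c * b / 2 * eta - 20 * c * rho ^+ 2) / h).
Proof.
move=> s1 h0 hN r0 r4 b0 bi PE etaS.
pose v (j : nat) : R := s * (rho * c * b / 2 * h * (j.+1 - i)%:R).
have sg0 : 0 <= rho * c * b / 2 * h.
  by rewrite mulr_ge0 ?(ltW h0)// divr_ge0// !mulr_ge0// ltW.
have vru j : `|v j| <= rho * energy c h j.
  rewrite /v normrM s1 mul1r ger0_norm; last exact: mulr_ge0.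
  have [ji|ij] := leqP j.+1 i.
    rewrite (eqP (_ : j.+1 - i == 0)%N) ?subn_eq0// mulr0; apply: mulr_ge0 => //.
    by rewrite ltW// energy_gt0.
  rewrite /energy triE.
  have -> : rho * (c * h ^+ 2 * (j.+1%:R * j.+2%:R / 2)) =
      rho * c / 2 * h * ((j.+2%:R * h) * j.+1%:R) by field.
  have -> : rho * c * b / 2 * h * (j.+1 - i)%:R = rho * c / 2 * h * (b * (j.+1 - i)%:R) by ring.
  apply: ler_wpM2l.
    by rewrite mulr_ge0 ?(ltW h0)// divr_ge0// !mulr_ge0// ltW.
  apply: ler_pM => //; last by rewrite ler_nat leq_subr.
  by apply: le_trans bi _; rewrite ler_pM2r// ler_nat; lia.
have PB e : P e -> rho * c * b / 2 * h * (s * a) <= \sum_(j < J) v j * (e j)%:R.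
  move=> /PE[_ sa]; apply: (@le_trans _ _ (rho * c * b / 2 * h * (s * (config_row e i)%:R))).
    exact: ler_wpM2l.
  rewrite /config_row /rows natr_sum !mulr_sumr le_eqVlt; apply/orP; left; apply/eqP.
  by apply: eq_bigr => j _; rewrite natrM /v; ring.
have := chernoff_energy h0 r0 r4 vru PB.
have cN : c * h ^+ 2 * N%:R = c / h.
  apply: (mulIf (lt0r_neq0 h0)); rewrite divfK ?gt_eqF//.
  by rewrite -[RHS]mulr1 -[X in _ = c * X]hN; ring.
have -> : \sum_(e | P e) boltz (energy c h) e = #|P|%:R * expR (- (c / h)).
  transitivity (\sum_(e in P) expR (- (c / h))).
    by apply: eq_bigr => e /PE[eN _]; rewrite boltz_energy eN cN.
  by rewrite sumr_const mulr_natl.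
rewrite expRN ler_pdivrMr ?expR_gt0// => /le_trans; apply.
rewrite -[leLHS]mulrA [expR _ * expR (c / h)]mulrC [leLHS]mulrA.
have Z0 : 0 < partition_fun J (energy c h).
  by apply: partition_fun_gt0 => j; exact: energy_gt0.
rewrite ler_pM2l; last by rewrite mulr_gt0// expR_gt0.
rewrite ler_expR mulNr mulrBl opprB addrC lerD2l.
have -> : \sum_(j < J) v j * bose (energy c h j) =
    rho * c * b / 2 * h * (s * \sum_(j < J) (j.+1 - i)%:R * bose (energy c h j)).
  by rewrite !mulr_sumr; apply: eq_bigr => j _; rewrite /v; move: (bose _) => x; ring.
move: etaS; move: (\sum_(j < J) _) => S etaS.
rewrite -lerN2 opprK -subr_ge0.
have -> : - (- (rho * c * b / 2 * h * (s * a)) + rho * c * b / 2 * h * (s * S)) -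
    rho * c * b / 2 * eta / h =
    rho * c * b / 2 * h / h ^+ 2 * (s * (h ^+ 2 * a - h ^+ 2 * S) - eta).
  by field; rewrite gt_eqF.
by rewrite mulr_ge0 ?subr_ge0// divr_ge0 ?sqr_ge0.
Qed.
Lemma expR_N3_le : expR (- 3) <= 4^-1 :> R.
Proof. by rewrite expRN lef_pV2 ?posrE ?expR_gt0//; have := @expR_ge1Dx R 3; lra. Qed.

Lemma oversize_le (kap h : R) (J K N : nat) : 0 < kap -> kap <= 1 -> 0 < h ->
  h ^+ 3 * N%:R = (1 + kap) ^+ 3 -> 4 <= c * kap ^+ 2 / 320 / h ->
  \sum_(e : {ffun 'I_J -> 'I_K} | (N < config_weight e)%N) boltz (energy c h) e <=
    partition_fun J (energy c h) / 4.
Proof.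
move=> k0 k1 h0 hN big4; pose tau := kap / 80.
have t0 : 0 <= tau by rewrite divr_ge0// ltW.
have t4 : tau <= 4^-1 by rewrite /tau; lra.
have e0 j := energy_gt0 c0 j h0.
have vru j : `|tau * energy c h j| <= tau * energy c h j.
  by rewrite ger0_norm// mulr_ge0// ltW.
have PB (e : {ffun 'I_J -> 'I_K}) : (N < config_weight e)%N ->
    tau * (c * h ^+ 2 * N%:R) <= \sum_(j < J) tau * energy c h j * (e j)%:R.
  move=> Ne; under eq_bigr do rewrite -mulrA; rewrite -mulr_sumr energy_sum.
  apply: ler_wpM2l => //; apply: ler_wpM2l; first by rewrite mulr_ge0 ?sqr_ge0// ltW.
  by rewrite ler_nat ltnW.
apply: le_trans (chernoff_energy h0 t0 t4 vru PB) _.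
have Z0 : 0 < partition_fun J (energy c h) by exact: partition_fun_gt0.
rewrite ler_pM2l//; apply: le_trans expR_N3_le; rewrite ler_expR.
under eq_bigr do rewrite -mulrA; rewrite -mulr_sumr.
have := energy_sum_le c0 norm1 J h0; move: (\sum_(j < J) _) => S SC.
have cN : c * h ^+ 2 * N%:R = (1 + kap) ^+ 3 * (c / h).
  by rewrite -hN; field; rewrite gt_eqF.
have ch0 : 0 < c / h by exact: divr_gt0.
have -> : 20 * c * tau ^+ 2 / h = 20 * tau ^+ 2 * (c / h) by ring.
rewrite cN.
have big5 : 4 <= kap ^+ 2 / 320 * (c / h).
  by move: big4; congr (_ <= _); ring.
have tS : tau * S <= tau * (c / h) by exact: ler_wpM2l.
have k3 : 1 + 3 * kap <= (1 + kap) ^+ 3.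
  have : 0 <= kap ^+ 2 by exact: sqr_ge0.
  have : 0 <= kap ^+ 3 by rewrite exprn_ge0// ltW.
  by lra.
have tk : tau * ((1 + 3 * kap) * (c / h)) <= tau * ((1 + kap) ^+ 3 * (c / h)).
  by rewrite ler_wpM2l// ler_wpM2r// ltW.
have E : 20 * tau ^+ 2 * (c / h) - 3 * tau * kap * (c / h) = - 11 * (kap ^+ 2 / 320 * (c / h)).
  by rewrite /tau; field; rewrite gt_eqF.
move: (c / h) big5 tS tk E => X; lra.
Qed.

Lemma undersize_le (kap : R) : 0 < kap -> kap <= 1 -> exists Y : R, forall (h : R) (J K : nat),
  0 < h -> Y <= J%:R * h -> 4 <= c * kap ^+ 2 / 320 / h ->
  \sum_(e : {ffun 'I_J -> 'I_K} | (config_weight e)%:R < (1 - kap) / h ^+ 3) boltz (energy c h) e <=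
    partition_fun J (energy c h) / 4.
Proof.
(* The mean is taken within kap / 2 of h^(-3), leaving a relative gap kap / 2 to the threshold. The
   hypothesis with 4 then leaves exponent -3 after the correction kap / 40 caused by the loss 2
   h. *)
move=> k0 k1; have [Y HY] := energy_sum_ge c0 norm1 (divr_gt0 k0 (ltr0Sn R 1)).
exists Y => h J K h0 YJ big4; pose tau := kap / 80.
have t0 : 0 <= tau by rewrite divr_ge0// ltW.
have t4 : tau <= 4^-1 by rewrite /tau; lra.
have e0 j := energy_gt0 c0 j h0.
have vru j : `|- tau * energy c h j| <= tau * energy c h j.
  by rewrite mulNr normrN ger0_norm// mulr_ge0// ltW.
have PB (e : {ffun 'I_J -> 'I_K}) : (config_weight e)%:R < (1 - kap) / h ^+ 3 ->
    - tau * (c * h ^+ 2 * ((1 - kap) / h ^+ 3)) <= \sum_(j < J) - tau * energy c h j * (e j)%:R.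
  move=> Ne; under eq_bigr do rewrite -mulrA; rewrite -mulr_sumr energy_sum.
  rewrite !mulNr lerN2; apply: ler_wpM2l => //.
  by apply: ler_wpM2l; [rewrite mulr_ge0 ?sqr_ge0// ltW|exact: ltW].
apply: le_trans (chernoff_energy h0 t0 t4 vru PB) _.
have Z0 : 0 < partition_fun J (energy c h) by exact: partition_fun_gt0.
rewrite ler_pM2l//; apply: le_trans expR_N3_le; rewrite ler_expR.
under eq_bigr do rewrite -mulrA; rewrite -mulr_sumr.
have := HY h J h0 YJ; move: (\sum_(j < J) _) => S SC.
have cN : c * h ^+ 2 * ((1 - kap) / h ^+ 3) = (1 - kap) * (c / h).
  by field; rewrite gt_eqF.
have -> : 20 * c * tau ^+ 2 / h = 20 * tau ^+ 2 * (c / h) by ring.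
rewrite cN.
have big5 : 4 <= kap ^+ 2 / 320 * (c / h).
  by move: big4; congr (_ <= _); ring.
have tS := ler_wpM2l t0 SC.
have E : tau * ((c * (1 - kap / 2) - 2 * h) / h) =
    tau * (c / h) - tau * kap / 2 * (c / h) - kap / 40.
  by rewrite /tau; field; rewrite gt_eqF.
have E2 : 20 * tau ^+ 2 * (c / h) - tau * kap / 2 * (c / h) = - (kap ^+ 2 / 320 * (c / h)).
  by rewrite /tau; field; rewrite gt_eqF.
rewrite E in tS; move: (c / h) big5 tS E2 => X; lra.
Qed.

(* A configuration of weight m <= N becomes one of weight N by adding N - m parts equal to 1,
   so it suffices that the weight concentrates just below N at the larger mesh (1 + kap) h. *)
Lemma count_lower (kap : R) : 0 < kap -> kap <= 1 -> exists Y : R, forall (h : R) (J N : nat),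
  0 < h -> h ^+ 3 * N%:R = 1 -> h <= c * kap ^+ 2 / 2560 -> Y <= J%:R * h -> (0 < J)%N ->
  partition_fun J (energy c h) * expR (c / h) * expR (- (5 * kap * c / h)) <=
    4 * N.+1%:R * #|` fset_set (of_size convex_partitions N)|%:R.
Proof.
move=> k0 k1; have [Y HY] := undersize_le k0 k1.
exists Y => h J N h0 hN hsmall YJ J0.
pose h' := (1 + kap) * h.
have h'0 : 0 < h' by rewrite mulr_gt0// addr_gt0.
have hh' : h <= h' by rewrite /h' ler_peMl ?(ltW h0)//; lra.
have h'h : h' <= 2 * h by rewrite /h' ler_pM2r//; lra.
(* The 2560 of the hypothesis is 4 times 320 times the factor 2 between h' and h. *)
have big4 : 4 <= c * kap ^+ 2 / 320 / h' by rewrite ler_pdivlMr//; lra.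
have h'N : h' ^+ 3 * N%:R = (1 + kap) ^+ 3.
  by rewrite /h' exprMn -mulrA hN mulr1.
have YJ' : Y <= J%:R * h' by apply: le_trans YJ _; rewrite ler_wpM2l.
have e0 j := energy_gt0 c0 j h0.
have e'0 j := energy_gt0 c0 j h'0.
set Z := partition_fun J (energy c h).
set Z' := partition_fun J (energy c h').
have Z'0 : 0 < Z' by exact: partition_fun_gt0.
have Z0 : 0 < Z by exact: partition_fun_gt0.
(* Once the truncated total exceeds 3/4 of Z', removing the oversized and undersized quarters leaves
   at least Z' / 4. *)
have [K HK] : exists K, 3 / 4 * Z' <= \sum_(e : {ffun 'I_J -> 'I_K}) boltz (energy c h') e.
  have /cvgr_gt/(_ (3 / 4 * Z')) := cvg_truncated_partition_fun (J := J) e'0.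
  rewrite -/Z' => /(_ _)[|K _ HK]; first by lra.
  exists K; have := HK K (leqnn K) => /ltW.
  rewrite /= -(sum_ffun_exp J K (fun j => - energy c h' j)).
  congr (_ <= _); apply: eq_bigr => e _; rewrite /boltz -sumrN; congr expR.
  by apply: eq_bigr => j _; rewrite mulNr.
pose m0 : R := (1 - kap) / h' ^+ 3.
pose P3 := [pred e : {ffun 'I_J -> 'I_K} |
  (config_weight e <= N)%N && (m0 <= (config_weight e)%:R)].
have good : Z' / 4 <= \sum_(e | P3 e) boltz (energy c h') e.
  have b1 := oversize_le J K k0 k1 h'0 h'N big4.
  have b2 := HY h' J K h'0 YJ' big4.
  have : \sum_(e : {ffun 'I_J -> 'I_K}) boltz (energy c h') e <=
      \sum_(e : {ffun 'I_J -> 'I_K} | (N < config_weight e)%N) boltz (energy c h') e +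
      \sum_(e : {ffun 'I_J -> 'I_K} | (config_weight e)%:R < m0) boltz (energy c h') e +
      \sum_(e | P3 e) boltz (energy c h') e.
    rewrite [X in _ <= X + _ + _]big_mkcond [X in _ <= _ + X + _]big_mkcond.
    rewrite [X in _ <= _ + X]big_mkcond -!big_split/=; apply: ler_sum => e _.
    have := expR_ge0 (- \sum_(j < J) energy c h' j * (e j)%:R); rewrite -/(boltz (energy c h') e).
    move: (boltz _ _) => B B0; rewrite [(N < _)%N]ltnNge [_ < m0]ltNge.
    by case: (config_weight e <= N)%N; case: (m0 <= _) => /=; lra.
  move: b1 b2 HK; rewrite -/Z' -/m0.
  move: (\sum_(e | _) _) (\sum_(e | _ < m0) _) (\sum_(e | P3 e) _).
  by move=> A B C; lra.
(* Each of the N + 1 possible weights m <= N accounts for at most as many configurations as there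
   are convex partitions of N. *)
have card : (#|P3| <= N.+1 * #|` fset_set (of_size convex_partitions N)|)%N.
  rewrite -sum1_card (partition_big (fun e => inord (config_weight e) : 'I_N.+1) xpredT)//=.
  rewrite -[N.+1 in leqRHS]card_ord -sum_nat_const; apply: leq_sum => m _.
  rewrite sum1_card; apply: leq_trans (convex_count_ge K (_ : (m <= N)%N) J0); last first.
    by rewrite -ltnS.
  apply: subset_leq_card; apply/fintype.subsetP => e; rewrite !inE.
  move=> /andP[/andP[eN _] /eqP <-]; rewrite inordK// ltnS.
have Sle : \sum_(e | P3 e) boltz (energy c h') e <= #|P3|%:R * expR (- ((1 - kap) * (c / h'))).
  rewrite mulr_natl -sumr_const; apply: ler_sum => e; rewrite inE => /andP[_ m0e].
  rewrite boltz_energy ler_expR lerN2.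
  have -> : (1 - kap) * (c / h') = c * h' ^+ 2 * m0 by rewrite /m0; field; rewrite gt_eqF.
  by rewrite ler_wpM2l// mulr_ge0 ?sqr_ge0 ?(ltW c0).
(* Returning from mesh h' to h costs (1 + kap)^2 - 1 <= 3 kap in units of c / h; with the 2 kap lost
   in [chh] this makes the 5 kap of the statement. *)
have ZZ : Z <= Z' * expR (3 * kap * (c / h)).
  have ee' j : energy c h j <= energy c h' j.
    rewrite /energy ler_wpM2r// ler_wpM2l ?(ltW c0)// lerXn2r// nnegrE; exact: ltW.
  apply: le_trans (partition_fun_ratio J e0 ee') _; rewrite ler_pM2l// ler_expR.
  have -> : \sum_(j < J) (energy c h' j - energy c h j) * bose (energy c h j) =
      ((1 + kap) ^+ 2 - 1) * \sum_(j < J) energy c h j * bose (energy c h j).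
    rewrite mulr_sumr; apply: eq_bigr => j _; rewrite mulrA; congr (_ * _).
    by rewrite /energy /h'; ring.
  apply: ler_pM.
  - by have : 0 <= kap ^+ 2 by [exact: sqr_ge0]; lra.
  - by apply: sumr_ge0 => j _; exact: mul_bose_ge0.
  - have : kap ^+ 2 <= kap by rewrite expr2 ler_piMr// ltW.
    by lra.
  - exact: energy_sum_le.
have chh : (1 - 2 * kap) * (c / h) <= (1 - kap) * (c / h').
  have -> : (1 - kap) * (c / h') = (1 - kap) / (1 + kap) * (c / h).
    by rewrite /h'; field; rewrite !gt_eqF// addr_gt0.
  rewrite ler_wpM2r//; first by rewrite divr_ge0// ltW.
  rewrite ler_pdivlMr; last by rewrite addr_gt0.
  have : 0 <= kap ^+ 2 by exact: sqr_ge0.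
  by lra.
have fin : Z' / 4 <= N.+1%:R * #|` fset_set (of_size convex_partitions N)|%:R *
    expR (- ((1 - 2 * kap) * (c / h))).
  apply: le_trans good _; apply: le_trans Sle _.
  by rewrite -natrM; apply: ler_pM; rewrite ?expR_ge0// ?ler_nat// ler_expR lerN2.
have -> : expR (- (5 * kap * c / h)) =
    expR (- (3 * kap * (c / h))) * expR ((1 - 2 * kap) * (c / h)) / expR (c / h).
  by rewrite -expRD -expRB; congr expR; ring.
rewrite !expRN in ZZ fin *; move: ZZ fin (expR_gt0 (3 * kap * (c / h))) (expR_gt0 (c / h)).
move: (expR_gt0 ((1 - 2 * kap) * (c / h))).
move: (expR (3 * _ * _)) (expR (c / h)) (expR _) => a b d d0 ZZ fin a0 b0.
rewrite ler_pdivlMr// in fin.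
have -> : Z * b * (a^-1 * d / b) = Z / a * d by field; rewrite !gt_eqF.
have : Z / a <= Z' by rewrite ler_pdivrMr.
move/(ler_wpM2r (ltW d0)) => /le_trans; apply; move: fin.
by rewrite -mulrA; move: (_%:R * _) => Q; lra.
Qed.
End Concentration.

(** * The uniform distribution on convex partitions *)

Lemma cvg_powR_natr (R : realType) (p : R) : 0 < p -> (n%:R `^ p : R) @[n --> \oo] --> +oo.
Proof.
move=> p0; apply/cvgryPge => A; near=> n.
have An : `|A| `^ p^-1 <= n%:R by near: n; exact: nbhs_infty_ger.
apply: le_trans (ler_norm A) _.
have -> : `|A| = (`|A| `^ p^-1) `^ p by rewrite -powRrM mulVf ?gt_eqF// powRr1.
by rewrite ge0_ler_powR ?nnegrE ?powR_ge0// ltW.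
Unshelve. all: by end_near. Qed.

Section UniformConvex.
Context (R : realType).
Local Notation prob := (@uniform_prob_of_size R cvx).
Local Notation fs n E := (fset_set (of_size cvx n `&` E)).

Lemma convex_count_gt0 (n : nat) : (0 < n)%N -> (0 < #|` fset_set (of_size cvx n)|)%N.
Proof.
move=> n0; rewrite cardfs_gt0; apply/fset0Pn; exists [:: n].
rewrite in_fset_set; last by apply: finite_of_size => l [].
by rewrite inE; split; [split; [split; rewrite //= n0|]|rewrite /= addn0].
Qed.

Lemma prob_ge0 (n : nat) (E : set (seq nat)) : 0 <= prob n E.
Proof. exact: divr_ge0. Qed.

Lemma probU (n : nat) (E F : set (seq nat)) : prob n (E `|` F) <= prob n E + prob n F.
Proof.
rewrite /uniform_prob_of_size -mulrDl ler_wpM2r ?invr_ge0//.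
rewrite setIUr fset_setU; [|exact: finite_convex..].
by rewrite cardfsU -natrD ler_nat leq_subr.
Qed.

Lemma prob_le (n : nat) (E F : set (seq nat)) :
  of_size cvx n `&` E `<=` F -> prob n E <= prob n F.
Proof.
move=> EF; rewrite /uniform_prob_of_size ler_wpM2r ?invr_ge0// ler_nat.
apply: fsubset_leq_card; rewrite -fset_set_sub; [|exact: finite_convex..].
by move=> l [Al El]; split => //; apply: EF.
Qed.

Lemma probC (n : nat) (E : set (seq nat)) : (0 < n)%N -> prob n (~` E) = 1 - prob n E.
Proof.
move=> n0; have p0 := convex_count_gt0 n0.
have finA : finite_set (of_size cvx n) by apply: finite_of_size => l [].
rewrite /uniform_prob_of_size.
have EA : (fs n E `<=` fset_set (of_size cvx n))%fset.
  by rewrite -fset_set_sub//; exact: finite_convex.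
have -> : of_size cvx n `&` ~` E = of_size cvx n `\` (of_size cvx n `&` E).
  by rewrite setDE setCI setIUr setICr set0U.
rewrite fset_setD//; last exact: finite_convex.
rewrite cardfsD (fsetIidPr EA) natrB ?fsubset_leq_card// mulrBl divff//.
by rewrite pnatr_eq0 -lt0n.
Qed.
End UniformConvex.

Definition mesh (R : realType) (n : nat) : R := (n%:R `^ 3^-1)^-1.

Section Mesh.
Context (R : realType).
Local Notation mesh := (@mesh R).

Lemma mesh_gt0 (n : nat) : (0 < n)%N -> 0 < mesh n.
Proof. by move=> n0; rewrite invr_gt0 powR_gt0// ltr0n. Qed.

Lemma cbrtE (n : nat) : (n%:R `^ 3^-1 : R) ^+ 3 = n%:R.
Proof. by rewrite -powR_mulrn ?powR_ge0// -powRrM mulVf// powRr1. Qed.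

Lemma mesh3 (n : nat) : (0 < n)%N -> mesh n ^+ 3 * n%:R = 1.
Proof. by move=> n0; rewrite /mesh exprVn cbrtE mulVf// pnatr_eq0 -lt0n. Qed.

Lemma alphaE (n : nat) : (0 < n)%N -> n%:R `^ (2 / 3) = (mesh n ^+ 2)^-1.
Proof.
move=> n0; rewrite /mesh exprVn invrK -powR_mulrn ?powR_ge0// -powRrM.
by congr (_ `^ _); rewrite mulrC.
Qed.

Lemma alpha_div (n : nat) : (0 < n)%N -> n%:R `^ (2 / 3) / n%:R = mesh n.
Proof.
move=> n0; rewrite alphaE//; have m0 := mesh_gt0 n0; have m3 := mesh3 n0.
have n0' : n%:R != 0 :> R by rewrite pnatr_eq0 -lt0n.
have mn0 := lt0r_neq0 m0.
apply: (mulIf n0'); rewrite divfK//; apply: (mulfI (expf_neq0 2 mn0)).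
by rewrite divff ?expf_neq0// mulrA -exprSr m3.
Qed.

Lemma cvg_mesh : mesh n @[n --> \oo] --> 0.
Proof.
apply/(@gtr0_cvgV0 _ _ _ _ (fun n => n%:R `^ 3^-1)); last exact: cvg_powR_natr.
by near=> n; rewrite powR_gt0// ltr0n; near: n; exact: nbhs_infty_gt.
Unshelve. all: by end_near. Qed.

Lemma mesh_small (e : R) : 0 < e -> \forall n \near \oo, (0 < n)%N /\ mesh n <= e.
Proof.
move=> e0; near=> n; split; first by near: n; exact: nbhs_infty_gt.
by near: n; have := cvgr_le _ cvg_mesh; apply.
Unshelve. all: by end_near. Qed.
End Mesh.

Section Deviations.
Context (R : realType) (c : R) (c0 : 0 < c).
Local Notation mu := (@lebesgue_measure R).
Context (norm1 : (\int[mu]_(y in `]0%R, +oo[) (y ^+ 2 / 2 * gam c y)%:E = 1)%E).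
Local Notation prob := (@uniform_prob_of_size R cvx).
Local Notation mesh := (@mesh R).
Local Notation alpha := (fun n => n%:R `^ (2 / 3) : R).

Lemma expRN_le_pow4 (x : R) : 0 < x -> expR (- x) <= 24 / x ^+ 4.
Proof.
move=> x0; rewrite expRN -[leRHS]invrK invf_div lef_pV2 ?posrE ?expR_gt0//.
  by have := expR_ge1Dxn 3 (ltW x0); rewrite (_ : 4`!%:R = 24)//; apply: le_trans; rewrite lerDr.
by rewrite divr_gt0// exprn_gt0.
Qed.

(** Passage from Boltzmann to uniform probability: [rows_deviation] bounds the bad partitions,
    [count_lower] the total. The number of columns is free beyond a threshold that may depend on
    n. *)
Lemma dev_cvg0 (s eta b : R) (E : set (seq nat)) (a : nat -> R) (i : nat -> nat) :
  `|s| = 1 -> 0 < eta -> 0 < b ->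
  (\forall n \near \oo, [/\ b <= (i n).+1%:R * mesh n,
     forall l, cvx l -> sumn l = n -> E l -> s * a n <= s * (nth 0%N l (i n))%:R
   & exists J0 : nat, forall J : nat, (J0 <= J)%N ->
     eta <= s * (mesh n ^+ 2 * a n -
       mesh n ^+ 2 * \sum_(j < J) (j.+1 - i n)%:R * bose (energy c (mesh n) j))]) ->
  prob n E @[n --> \oo] --> 0.
Proof.
move=> s1 eta0 b0 H.
(* With rho <= b eta / 80 the loss 20 c rho^2 is at most half of the gain rho c b eta / 2; [e1] is
   the remaining half. *)
pose rho := Num.min 4^-1 (b * eta / 80).
have r0 : 0 < rho by rewrite lt_min invr_gt0 ltr0n/= divr_gt0// mulr_gt0.
have r4 : rho <= 4^-1 by rewrite ge_min lexx.
have rb : rho <= b * eta / 80 by rewrite ge_min lexx orbT.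
pose e1 := rho * c * b * eta / 4.
have e10 : 0 < e1 by rewrite divr_gt0// !mulr_gt0.
have e1le : e1 <= rho * c * b / 2 * eta - 20 * c * rho ^+ 2.
  have : 0 <= 20 * c * rho * (b * eta / 80 - rho) by rewrite mulr_ge0 ?subr_ge0// !mulr_ge0// ltW.
  by rewrite /e1; lra.
(* The lower bound for the total then gives up at most half of [e1], so a factor exp (- e1 / (2 h))
   remains. *)
pose kap := Num.min 1 (e1 / (10 * c)).
have k0 : 0 < kap by rewrite lt_min ltr01/= divr_gt0// mulr_gt0.
have k1 : kap <= 1 by rewrite ge_min lexx.
have ke : 5 * kap * c <= e1 / 2.
  have : kap <= e1 / (10 * c) by rewrite ge_min lexx orbT.
  by rewrite ler_pdivlMr ?mulr_gt0//; lra.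
have [Y HY] := count_lower c0 norm1 k0 k1.
have bound : \forall n \near \oo, prob n E <= 3072 / e1 ^+ 4 * mesh n.
  near=> n.
  have [n0 hs] : (0 < n)%N /\ mesh n <= c * kap ^+ 2 / 2560.
    by near: n; apply: mesh_small; rewrite divr_gt0 ?ltr0n// mulr_gt0 ?exprn_gt0.
  have [bi El [J0 HJ]] : [/\ b <= (i n).+1%:R * mesh n,
     forall l, cvx l -> sumn l = n -> E l -> s * a n <= s * (nth 0%N l (i n))%:R
   & exists J0 : nat, forall J : nat, (J0 <= J)%N ->
     eta <= s * (mesh n ^+ 2 * a n -
       mesh n ^+ 2 * \sum_(j < J) (j.+1 - i n)%:R * bose (energy c (mesh n) j))].
    by near: n.
  have h0 := mesh_gt0 R n0; have hN := mesh3 R n0.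
  move: (mesh n) hs bi HJ h0 hN => h hs bi HJ h0 hN.
  pose J := maxn (maxn J0 n) (Num.truncn (Y / h)).+1.
  have JJ0 : (J0 <= J)%N by rewrite /J !leq_max leqnn.
  have nJ : (n <= J)%N by rewrite /J !leq_max leqnn orbT.
  have Jgt0 : (0 < J)%N by exact: leq_trans nJ.
  have YJ : Y <= J%:R * h.
    rewrite -ler_pdivrMr// (le_trans (ltW (truncnS_gt _)))// ler_nat.
    by rewrite /J leq_max leqnn orbT.
  have low := HY h J n h0 hN hs YJ Jgt0.
  pose P := [pred f : {ffun 'I_J -> 'I_n.+1} |
    (config_weight f == n) && (s * a n <= s * (config_row f (i n))%:R)].
  have up : (#|` fset_set (of_size cvx n `&` E)| <= #|P|)%N.
    apply: convex_count_le => // l e cl ln Ell re we f fe.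
    have ffe : (fun j => nat_of_ord (f j)) =1 e by [].
    have -> : P f = ((weight e == n) && (s * a n <= s * (rows e (i n))%:R)).
      rewrite /P/= /config_weight /config_row (_ : weight _ = weight e); last first.
        by apply: eq_bigr => j _; rewrite ffe.
      by rewrite (_ : rows _ (i n) = rows e (i n))//; apply: eq_bigr => j _; rewrite ffe.
    by rewrite we eqxx re El.
  have PE f : P f -> config_weight f = n /\ s * a n <= s * (config_row f (i n))%:R.
    by case/andP => /eqP.
  have dev := rows_deviation c0 norm1 s1 h0 hN (ltW r0) r4 (ltW b0) bi PE (HJ J JJ0).
  have p0 := convex_count_gt0 n0.
  rewrite /uniform_prob_of_size ler_pdivrMr ?ltr0n//.
  have {}up : #|` fset_set (of_size cvx n `&` E)|%:R <= #|P|%:R :> R by rewrite ler_nat.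
  have {}dev := le_trans up dev.
  set bad := #|` fset_set (of_size cvx n `&` E)|%:R in dev *.
  set total := #|` fset_set (of_size cvx n)|%:R in low *.
  have total0 : 0 <= total by [].
  have Z0 : 0 < partition_fun J (energy c h).
    by apply: partition_fun_gt0 => j; exact: energy_gt0.
  set Z := partition_fun J (energy c h) * expR (c / h) in dev low.
  have {}Z0 : 0 < Z by rewrite mulr_gt0// expR_gt0.
  have hV : 0 < h^-1 by rewrite invr_gt0.
  have {}dev : bad <= Z * (expR (- (5 * kap * c / h)) * expR (- (e1 / 2 / h))).
    apply: le_trans dev _; rewrite ler_pM2l// -expRD ler_expR.
    have : 5 * kap * c / h <= e1 / 2 / h by rewrite ler_pM2r.
    have : e1 / h <= (rho * c * b / 2 * eta - 20 * c * rho ^+ 2) / h by rewrite ler_pM2r.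
    by rewrite [- _ / h]mulNr; clear; lra.
  have x0 : 0 < e1 / 2 / h by rewrite divr_gt0// divr_gt0.
  apply: le_trans dev _; rewrite mulrA.
  (* The polynomial factor is of order n = h^(-3), so decay of order h^4 leaves one power of the
     mesh. *)
  apply: (@le_trans _ _ (4 * n.+1%:R * total * (24 / (e1 / 2 / h) ^+ 4))).
    apply: ler_pM; [|exact: expR_ge0|exact: low|exact: expRN_le_pow4].
    by rewrite mulr_ge0 ?expR_ge0// ltW.
  rewrite (mulrAC _ total) ler_wpM2r//.
  have n2 : n.+1%:R <= 2 * n%:R :> R by rewrite -natrM ler_nat mul2n -addnn -addn1 leq_add2l.
  apply: (@le_trans _ _ (4 * (2 * n%:R) * (24 / (e1 / 2 / h) ^+ 4))).
    rewrite ler_wpM2r//; first by rewrite divr_ge0// exprn_ge0// ltW.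
    by rewrite ler_wpM2l.
  have -> : 4 * (2 * n%:R) * (24 / (e1 / 2 / h) ^+ 4) = 3072 / e1 ^+ 4 * h * (h ^+ 3 * n%:R).
    by field; rewrite !gt_eqF.
  by rewrite hN mulr1.
apply: (@squeeze_cvgr _ _ _ _ (fun=> 0) (fun n => 3072 / e1 ^+ 4 * mesh n)).
- near=> n; rewrite prob_ge0/=; near: n; exact: bound.
- exact: cvg_cst.
- rewrite -[X in _ --> X](mulr0 (3072 / e1 ^+ 4)).
  by apply: cvgM; [exact: cvg_cst|exact: cvg_mesh].
Unshelve. all: by end_near. Qed.
End Deviations.

Section LimitShapeProof.
Context (R : realType) (c : R) (c0 : 0 < c).
Local Notation mu := (@lebesgue_measure R).
Context (norm1 : (\int[mu]_(y in `]0%R, +oo[) (y ^+ 2 / 2 * gam c y)%:E = 1)%E).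
Local Notation prob := (@uniform_prob_of_size R cvx).
Local Notation mesh := (@mesh R).
Local Notation alpha := (fun n : nat => n%:R `^ (2 / 3) : R).
Local Notation C := (shape c).

Lemma scaled_diagramE (l : seq nat) (t : R) : (0 < sumn l)%N ->
  scaled_diagram alpha l t = mesh (sumn l) * diagram l ((mesh (sumn l) ^+ 2)^-1 * t).
Proof. by move=> n0; rewrite /scaled_diagram alpha_div// alphaE. Qed.

Lemma mesh_scale (n : nat) (t : R) : (0 < n)%N ->
  mesh n ^+ 2 * ((mesh n ^+ 2)^-1 * t) = t.
Proof. by move=> n0; rewrite mulrA mulfV ?mul1r// expf_neq0// gt_eqF// mesh_gt0. Qed.

(** If the diagram at t exceeds x + e, then row (x + e / 2) / h has length at least t / h^2, whereas
    its rescaled mean is at most tail1 c (x + e / 4), which is below tail1 c x = t. *)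
Lemma prob_above_cvg0 (t e : R) : 0 < t -> 0 < e ->
  prob n [set l | C t + e <= scaled_diagram alpha l t] @[n --> \oo] --> 0.
Proof.
move=> t0 e0; set x := C t; have x0 : 0 < x by exact: shape_gt0.
have xe0 : 0 < x + e / 4 by rewrite addr_gt0// divr_gt0.
apply: (@dev_cvg0 R c c0 norm1 1 (t - tail1 c (x + e / 4)) x _
  (fun n => (mesh n ^+ 2)^-1 * t) (fun n => Num.truncn ((x + e / 2) / mesh n))) => //.
- exact: normr1.
- by rewrite subr_gt0 -[ltRHS](tail1_shape c0 norm1 t0) tail1_lt// ltrDl divr_gt0.
near=> n.
have [n0 hs] : (0 < n)%N /\ mesh n <= e / 8.
  by near: n; apply: mesh_small; rewrite divr_gt0.
have h0 := mesh_gt0 R n0.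
set i := Num.truncn _.
have xeh : 0 <= (x + e / 2) / mesh n by rewrite divr_ge0// ltW// addr_gt0// divr_gt0.
have ilo : x + e / 2 < i.+1%:R * mesh n by rewrite -ltr_pdivrMr// truncnS_gt.
have ihi : i%:R * mesh n <= x + e / 2 by rewrite -ler_pdivlMr// truncn_le.
split.
- by rewrite ltW// (le_lt_trans _ ilo)// lerDl divr_ge0// ltW.
- move=> l [pl _] ln; rewrite /= scaled_diagramE ln// => le; rewrite !mul1r.
  rewrite -diagram_gt//; last by rewrite mulr_gt0// invr_gt0 exprn_gt0.
  rewrite -(ltr_pM2r h0) [ltRHS]mulrC.
  apply: le_lt_trans ihi _; apply: lt_le_trans le; rewrite ltrD2l.
  by rewrite ltr_pdivrMr// ltr_pMr// ltr1n.
- have i0 : (0 < i)%N.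
    rewrite lt0n; apply/eqP => i00; move: ilo; rewrite i00 mul1r.
    by move=> /lt_le_trans/(_ hs); have := x0; have := e0; clear; lra.
  (* Two meshes are lost, one by [truncn] and one by the shift in [rows_sum_le]; each is at most e /
     8. *)
  have i1 : x + e / 4 <= i.-1%:R * mesh n.
    have : i.+1%:R = i.-1%:R + 2 :> R by rewrite -{1}(prednK i0) -addn2 natrD.
    by move=> iE; move: ilo hs; rewrite iE mulrDl; move: (i.-1%:R * _) => y; clear; lra.
  exists i => J iJ; rewrite mul1r mesh_scale// lerD2l lerN2.
  have k0 : (0 < i.-1)%N.
    rewrite lt0n; apply/eqP => k00; move: i1; rewrite k00 mul0r leNgt.
    by rewrite xe0.
  have := rows_sum_le c0 norm1 h0 k0 (leq_trans (leq_pred i) iJ).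
  rewrite prednK// => /le_trans; apply.
  move: i1; rewrite le_eqVlt => /predU1P[->//|i1].
  by rewrite ltW// tail1_lt.
Unshelve. all: by end_near. Qed.

Lemma prob_below_cvg0 (t e : R) : 0 < t -> 0 < e -> e < C t ->
  prob n [set l | scaled_diagram alpha l t <= C t - e] @[n --> \oo] --> 0.
Proof.
move=> t0 e0; set x := C t => ex; have x0 : 0 < x by exact: shape_gt0.
have xe0 : 0 < x - e / 4 by move: e0 ex; clear; lra.
have xe2 : 0 < x - e / 2 by move: e0 ex; clear; lra.
(* Only half of the gap is used: the other half absorbs the truncation error 2 / ((J + 2) h) of
   [rows_sum_ge]. *)
pose eta := (tail1 c (x - e / 4) - t) / 2.
have eta0 : 0 < eta.
  rewrite divr_gt0// subr_gt0 -lt_shape// gtrBl divr_gt0//.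
apply: (@dev_cvg0 R c c0 norm1 (-1) eta (x - e / 2) _
  (fun n => (mesh n ^+ 2)^-1 * t) (fun n => Num.truncn ((x - e / 2) / mesh n))) => //.
- by rewrite normrN normr1.
near=> n.
have [n0 hs] : (0 < n)%N /\ mesh n <= e / 8.
  by near: n; apply: mesh_small; rewrite divr_gt0.
have h0 := mesh_gt0 R n0.
set i := Num.truncn _.
have xeh : 0 <= (x - e / 2) / mesh n by rewrite divr_ge0// ltW.
have ilo : x - e / 2 < i.+1%:R * mesh n by rewrite -ltr_pdivrMr// truncnS_gt.
have ihi : i%:R * mesh n <= x - e / 2 by rewrite -ler_pdivlMr// truncn_le.
have S1 : i.+1%:R * mesh n = i%:R * mesh n + mesh n by rewrite -natr1 mulrDl mul1r.
split.
- exact: ltW.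
- move=> l [pl _] ln; rewrite /= scaled_diagramE ln// => le.
  rewrite !mulN1r lerN2 leNgt; apply/negP => /ltW.
  rewrite -diagram_gt//; last by rewrite mulr_gt0// invr_gt0 exprn_gt0.
  rewrite -(ltr_pM2r h0) (mulrC (diagram _ _)) => /lt_le_trans/(_ le).
  by have := e0; move: ilo hs; rewrite S1; move: (i%:R * _) => y; clear; lra.
- exists (maxn i (Num.truncn (2 / (eta * mesh n)))) => J.
  rewrite geq_max => /andP[iJ JJ].
  have J2 : 2 / (J.+2%:R * mesh n) <= eta.
    have em0 : 0 < eta * mesh n by exact: mulr_gt0.
    have : 2 / (eta * mesh n) <= J.+2%:R.
      by rewrite (le_trans (ltW (truncnS_gt _)))// ler_nat ltnS (leq_trans JJ).
    by rewrite ler_pdivrMr// ler_pdivrMr ?mulr_gt0// mulrCA.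
  have := rows_sum_ge c0 norm1 h0 iJ.
  have i2 : i.+2%:R * mesh n <= x - e / 4.
    rewrite -natr1 mulrDl mul1r S1.
    by move: ihi hs; move: (i%:R * _) => y; clear; lra.
  have ti : tail1 c (x - e / 4) <= tail1 c (i.+2%:R * mesh n).
    move: i2; rewrite le_eqVlt => /predU1P[->//|i2].
    by rewrite ltW// tail1_lt// mulr_gt0.
  rewrite mesh_scale// mulN1r opprB; move: ti J2; rewrite /eta.
  move: (2 / (_ * _)) (mesh n ^+ 2 * _) (tail1 _ _) (tail1 _ _) => A B D F.
  by clear; lra.
Unshelve. all: by end_near. Qed.

Lemma prob_cvg0_le (f : nat -> R) (E : set (seq nat)) :
  f n @[n --> \oo] --> 0 -> (forall n, prob n E <= f n) -> prob n E @[n --> \oo] --> 0.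
Proof.
move=> f0 Ef; apply: (@squeeze_cvgr _ _ _ _ (fun=> 0) f) => //; last exact: cvg_cst.
by apply: nearW => n; rewrite prob_ge0 Ef.
Qed.

Lemma prob_deviation_cvg0 (t e : R) : 0 < t -> 0 < e ->
  prob n [set l | e <= `|scaled_diagram alpha l t - C t|] @[n --> \oo] --> 0.
Proof.
move=> t0 e0; have s0 := shape_gt0 c0 norm1 t0.
(* The bound from below requires a deviation smaller than C t, and shrinking the deviation only
   enlarges the event. *)
pose d := Num.min e (C t / 2).
have d0 : 0 < d by rewrite lt_min e0 divr_gt0.
have de : d <= e by rewrite ge_min lexx.
have ds : d < C t by rewrite gt_min ltr_pdivrMr// ltr_pMr// ltr1n orbT.
have H : (prob n [set l | C t + d <= scaled_diagram alpha l t] +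
    prob n [set l | scaled_diagram alpha l t <= C t - d]) @[n --> \oo] --> 0.
  rewrite -[X in _ --> X](addr0 0).
  by apply: cvgD; [exact: prob_above_cvg0|exact: prob_below_cvg0].
apply: (prob_cvg0_le H) => n; apply: le_trans (probU _ _ _ _).
apply: prob_le => l [_ /=]; rewrite ler_normr => /orP[h|h]; [left|right] => /=;
  by move: h de; clear; lra.
Qed.

Lemma prob_all_deviation_cvg0 (ts : seq R) (e : R) : 0 < e ->
  (forall t, t \in ts -> 0 < t) ->
  prob n [set l | exists2 t, t \in ts & e <= `|scaled_diagram alpha l t - C t|]
    @[n --> \oo] --> 0.
Proof.
move=> e0; elim: ts => [|t ts IH] ts0.
  apply: (@prob_cvg0_le (fun=> 0)) => [|n]; first exact: cvg_cst.
  rewrite /uniform_prob_of_size.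
  rewrite (_ : _ `&` _ = set0) ?fset_set0 ?cardfs0 ?mul0r//.
  by apply/seteqP; split=> // l [_ []].
have H : (prob n [set l | e <= `|scaled_diagram alpha l t - C t|] +
    prob n [set l | exists2 u, u \in ts & e <= `|scaled_diagram alpha l u - C u|])
    @[n --> \oo] --> 0.
  rewrite -[X in _ --> X](addr0 0); apply: cvgD.
    by apply: prob_deviation_cvg0 => //; exact: ts0 (mem_head _ _).
  by apply: IH => u uts; apply: ts0; rewrite inE uts orbT.
apply: (prob_cvg0_le H) => n; apply: le_trans (probU _ _ _ _).
apply: prob_le => l [_ [u]]; rewrite inE => /predU1P[->|uts] ue; [by left|right].
by exists u.
Qed.

Lemma scaling_alpha : scaling_function alpha.
Proof.
split.
- by move=> n n0; rewrite powR_gt0// ltr0n.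
- by move=> m n m0 mn; rewrite gt0_ltr_powR ?nnegrE ?ltr_nat// divr_gt0.
- by apply: cvg_powR_natr; rewrite divr_gt0.
Qed.

Lemma convex_limit_shape : is_limit_shape alpha cvx C.
Proof.
split.
- exact: scaling_alpha.
- by move=> t t0; rewrite ltW// shape_gt0.
- split=> [a b a0 ab|t t0].
    rewrite (_ : [set _ | _] = set0)//; apply/seteqP; split=> // t /= [/andP[at_ _]].
    by apply; apply: shape_continuous => //; exact: lt_le_trans at_.
  have ct := shape_continuous c0 norm1 t0.
  split; apply/cvg_ex; exists (C t).
    exact: cvg_at_left_filter.
  exact: cvg_at_right_filter.
- exact: integral_shape.
- move=> ts e _ ts0 e0.
  have H : prob n [set l | exists2 t, t \in ts & e <= `|scaled_diagram alpha l t - C t|]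
    @[n --> \oo] --> 0 by apply: prob_all_deviation_cvg0 => // t /ts0[].
  have {}H : (1 - prob n [set l | exists2 t, t \in ts & e <= `|scaled_diagram alpha l t - C t|])
      @[n --> \oo] --> (1 : R).
    by rewrite -[X in _ --> X](subr0 1); apply: cvgB => //; exact: cvg_cst.
  apply: cvg_trans H; apply: near_eq_cvg; near=> n.
  have n0 : (0 < n)%N by near: n; exact: nbhs_infty_gt.
  rewrite /= -probC//; congr uniform_prob_of_size; apply/seteqP; split=> l /=.
    by move=> nl t tts; rewrite ltNge; apply/negP => h; apply: nl; exists t.
  by move=> al [t tts]; rewrite leNgt al.
Unshelve. all: by end_near. Qed.

(** Bands of half-width |Phi t - Psi t| / 2 around two distinct values are disjoint, so their
    probabilities cannot both tend to 1. This justifies speaking of the limit shape. *)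
Lemma limit_shape_unique (Phi Psi : R -> R) (a : nat -> R) (t : R) :
  is_limit_shape a cvx Phi -> is_limit_shape a cvx Psi ->
  0 < t -> {for t, continuous Phi} -> {for t, continuous Psi} -> Phi t = Psi t.
Proof.
move=> [_ _ _ _ HPhi] [_ _ _ _ HPsi] t0 cPhi cPsi; apply/eqP/negPn/negP => neq.
pose e := `|Phi t - Psi t| / 2.
have e0 : 0 < e by rewrite divr_gt0// normr_gt0 subr_eq0.
have one s : s \in [:: t] -> s = t by rewrite inE => /eqP.
have tPhi s : s \in [:: t] -> 0 < s /\ {for s, continuous Phi} by move=> /one ->.
have tPsi s : s \in [:: t] -> 0 < s /\ {for s, continuous Psi} by move=> /one ->.
have P1 := HPhi [:: t] e isT tPhi e0.
have P2 := HPsi [:: t] e isT tPsi e0.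
have H : (1 - prob n [set l | forall s, s \in [:: t] -> `|scaled_diagram a l s - Psi s| < e])
    @[n --> \oo] --> (0 : R).
  by rewrite -[X in _ --> X](subrr 1); apply: cvgB => //; exact: cvg_cst.
have : (1 : R) <= 0.
  apply: (ler_cvg_to P1 H); near=> n.
  have n0 : (0 < n)%N by near: n; exact: nbhs_infty_gt.
  rewrite /= -probC//; apply: prob_le => l [_ /=] h1 h2.
  have := h1 t (mem_head _ _); have := h2 t (mem_head _ _).
  move: (scaled_diagram _ _ _) => D h3 h4.
  have := ler_normB (D - Psi t) (D - Phi t).
  rewrite (_ : D - Psi t - (D - Phi t) = Phi t - Psi t); last by ring.
  by move: h3 h4; rewrite /e; clear; lra.
by rewrite ler10.
Unshelve. all: by end_near. Qed.

Lemma tail1_comp_inverse : comp_inverse_pos C (tail1 c).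
Proof.
split=> [t /(shapeP c0 norm1)//|x x0]; split; first exact: tail1_gt0.
exact: shape_tail1.
Qed.

Lemma tail1_formula (x : R) : 0 < x ->
  (tail1 c x)%:E = (\int[mu]_(y in `]x, +oo[)
    ((y - x) * (expR (- (c * 2^-1 * y ^+ 2)) / (1 - expR (- (c * 2^-1 * y ^+ 2)))))%:E)%E.
Proof.
move=> x0; rewrite tail1E//; apply: eq_integral => y.
by rewrite inE/= in_itv/= andbT => xy; rewrite gamE// (lt_trans x0).
Qed.
End LimitShapeProof.

Theorem theorem2p6 (R : realType) :
  let alpha : nat -> R := fun n => n%:R `^ (2 / 3) in
  let c : R := convex_const R in
  exists C : R -> R,
    [/\ is_limit_shape alpha convex_partitions C,
        (forall Phi : R -> R, is_limit_shape alpha convex_partitions Phi ->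
           forall t : R, 0 < t -> {for t, continuous Phi} -> Phi t = C t)
      & exists Cinv : R -> R,
          comp_inverse_pos C Cinv /\
          (forall x : R, 0 < x ->
             (Cinv x)%:E =
             (\int[lebesgue_measure]_(y in `]x, +oo[)
                ((y - x) * (expR (- (c * 2^-1 * y ^+ 2)) /
                            (1 - expR (- (c * 2^-1 * y ^+ 2)))))%:E)%E)].
Proof.
move=> alpha c; have c0 : 0 < c := convex_const_gt0 R.
have norm1 := convex_const_normalizes R.
have HC := convex_limit_shape c0 norm1.
exists (shape c); split=> //.
  move=> Phi HPhi t t0 cPhi; apply: (limit_shape_unique HPhi HC t0 cPhi).
  exact: shape_continuous.
exists (tail1 c); split; first exact: tail1_comp_inverse.
by move=> x x0; exact: tail1_formula.
Qed.
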